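(* Let $H$ be a separable infinite-dimensional complex Hilbert space, let $K(H)$ be the Banach algebra of compact operators on $H$ with the operator norm, let $1\le p<\infty$, and let $\mathcal{S}_p(H)\subset K(H)$ be the Schatten $p$-class ideal. Then every derivation $D: K(H)\to \mathcal{S}_p(H)$ is inner and implemented by an element of $\mathcal{S}_p(H)$, i.e. there exists $x\in\mathcal{S}_p(H)$ such that $D(a)=ax-xa$ for all $a\in K(H)$.
   Context: The Schatten $p$-class $\mathcal{S}_p(H)$ is the set of all compact operators $T\in K(H)$ whose singular values $(s_n(T))_{n\ge 1}$ satisfy $\|T\|_p=\left(\sum_{n=1}^\infty s_n(T)^p\right)^{1/p}<\infty$. It is a two-sided ideal of $K(H)$, dense in the operator norm. For a Banach algebra $A$ and an ideal $I$ of $A$, a derivation $D: A\to I$ is a bounded linear map (here $I$ carries the norm of $A$, i.e. the operator norm) satisfying $D(ab)=aD(b)+D(a)b$ for all $a,b\in A$. It is inner, implemented by $x\in I$, if $D(a)=ax-xa$ for all $a\in A$. *)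

(* Defs.v *)
From HB Require Import structures.
From mathcomp Require Export all_boot all_order all_algebra.
From mathcomp Require Export all_classical all_reals all_analysis.
From mathcomp Require Export complex.

Export Order.TTheory GRing.Theory Num.Theory.
Export numFieldNormedType.Exports.

Set Implicit Arguments.
Unset Strict Implicit.
Unset Printing Implicit Defensive.

Local Open Scope classical_set_scope.
Local Open Scope card_scope.
Local Open Scope complex_scope.
Local Open Scope ring_scope.

(* A complex Hilbert space is a Banach space [H] over [R[i]], [R : realType],
   together with a positive definite hermitian form [ip : {dot H for Num.conj}]
   (linear in the first argument, conjugate-linear in the second) inducing the
   norm: [hilbert_form ip]. *)
Definition hilbert_form (R : realType) (H : completeNormedModType R[i])
    (ip : {dot H for (@Num.conj R[i])}) : Prop :=
  forall x : H, `|x| ^+ 2 = ip x x.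

Definition separable (T : topologicalType) : Prop :=
  exists2 A : set T, countable A & dense A.

Section Operators.
Variables (R : realType) (H : completeNormedModType R[i]).

Definition has_dim (V : set H) (d : nat) : Prop :=
  exists e : 'I_d -> H,
    (forall c : 'I_d -> R[i],
        \sum_(i < d) c i *: e i = 0 -> forall i, c i = 0) /\
    V = [set x | exists c : 'I_d -> R[i], x = \sum_(i < d) c i *: e i].

Definition infinite_dimensional : Prop := forall d, ~ has_dim [set: H] d.

Definition compact_operator : set (H -> H) :=
  [set T | linear T /\ precompact (T @` [set x | `|x| <= 1])].

(* The norm of [H] takes its values in [R[i]] (they are nonnegative reals);
   [complex.Re] brings it back to [R]. *)
Definition opnorm (T : H -> H) : R :=
  sup [set complex.Re `|T x| | x in [set x : H | `|x| <= 1]].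

Definition op_eigenspace (A : H -> H) (mu : R[i]) : set H :=
  [set x | A x = mu *: x].

Variable ip : {dot H for (@Num.conj R[i])}.

Definition is_adjoint (T T' : H -> H) : Prop :=
  forall x y, ip (T x) y = ip x (T' y).

(* [s] lists the square roots of the eigenvalues of [T^* T] in nonincreasing
   order and with multiplicity: each [lam > 0] occurs in [s] exactly
   [\dim (ker (T^* T - lam^2))] times. When [T^* T] has finitely many positive
   eigenvalues the remaining terms of [s] are forced to be [0]. Indices start
   at 0, so [s n] is $s_{n+1}(T)$. *)
Definition is_singular_values (T : H -> H) (s : nat -> R) : Prop :=
  [/\ forall n, 0 <= s n,
      forall m n, (m <= n)%N -> s n <= s m &
      exists2 T' : H -> H, is_adjoint T T' &
        forall lam : R, 0 < lam ->
          exists d : nat, [set n | s n = lam] #= `I_d /\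
            has_dim (op_eigenspace (T' \o T) (lam ^+ 2)%:C) d].

Definition lp_norm (p : R) (s : nat -> R) : \bar R :=
  poweR (\sum_(0 <= n <oo) (s n `^ p)%:E)%E p^-1.

Definition schatten (p : R) : set (H -> H) :=
  [set T | compact_operator T /\
     exists2 s, is_singular_values T s & (lp_norm p s < +oo)%E].

(* Bounded derivations from K(H) to [I], both with the operator norm. The values
   of [D] outside K(H) are unconstrained. *)
Definition is_derivation (I : set (H -> H)) (D : (H -> H) -> (H -> H)) : Prop :=
  [/\ forall a, compact_operator a -> I (D a),
      forall (c : R[i]) a b, compact_operator a -> compact_operator b ->
        D (c *: a + b) = c *: D a + D b,
      exists M : R, forall a, compact_operator a ->
        opnorm (D a) <= M * opnorm a &
      forall a b, compact_operator a -> compact_operator b ->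
        D (a \o b) = (a \o D b) + (D a \o b)].

End Operators.

(* Main.v *)
Require Import Defs.
From mathcomp Require Import ring lra.

(** Fixing a unit vector [eta], the operator [x h = - D (<., eta> h) eta]
implements [D]; it is bounded, and it has an adjoint because the operators
[D (<., h> eta)] do. Passing to a subsequence of an orthonormal sequence gives
a scalar [lam] and orthonormal [v_n] with [|<(x - lam) v_k, v_n>| <= 2^(-k-n)].
Put [y = x - lam]. For orthonormal sequences [e], [f] and weights [c_n]
decreasing to [0], the operator [a = \sum c_k <., f_k> v_k] is compact and
[<D(a) e_n, v_n> = c_n <y e_n, f_n> - <y a e_n, v_n>], where the last term is
[O(2^-n)]. As [D(a)] lies in the Schatten class, [\sum |<D(a) e_n, v_n>|^p] is
finite, hence so is [\sum |c_n <y e_n, f_n>|^p]; as [c] is arbitrary,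
[\sum |<y e_n, f_n>|^p] is finite for all [e], [f], which forces [y] to lie in
the Schatten class: choose for [e], [f] the singular vectors of [y]. *)

Set Implicit Arguments.
Unset Strict Implicit.
Unset Printing Implicit Defensive.

Local Open Scope classical_set_scope.
Local Open Scope complex_scope.
Local Open Scope ring_scope.

(** * Real-valued norms and orthonormal families *)

(** [D] does not see multiples of the identity, so [x] is only determined up to a scalar and need
    not be compact; the scalar [lam] has to be found before anything summable can appear. The
    sequence [v] serves to make the term [y a] harmless: boundedness of [y] would only bound
    [<y a e_n, v_n>], but [a] takes its values in the closed span of [v], and [y] compressed to that
    span is nearly zero. As [v] depends on [y] alone, one [v] serves all [e], [f] and [c]. The
    weights are the price of compactness: constant weights would finish at once, but the resulting
    [a] is not compact, so an Abel-Dini argument has to remove them.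

    Adjoints do not come from Riesz representation: the singular values of each value of [D] carry
    one, and those of [x] and [y] are assembled from these. Singular vectors come from maximizing
    the norm of [T u] successively on orthogonal complements, which gives eigenvectors of [T' \o T]
    without any spectral theory. *)

Section RealNorm.
Variable R : realType.

(** Suprema, real powers and linear arithmetic need the totally ordered field [R]; the order of
    [R[i]] is only partial. *)
Definition rnorm (V : normedZmodType R[i]) (x : V) : R := complex.Re `|x|.

Lemma rnormE (V : normedZmodType R[i]) (x : V) : `|x| = (rnorm x)%:C.
Proof. by rewrite /rnorm RRe_real// normr_real. Qed.

Variable V : normedZmodType R[i].
Implicit Types x y : V.

Lemma rnorm_ge0 x : 0 <= rnorm x.
Proof. by rewrite -lecR -rnormE normr_ge0. Qed.

Lemma rnorm0 : rnorm (0 : V) = 0.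
Proof. by rewrite /rnorm normr0. Qed.

Lemma rnorm_eq0 x : (rnorm x == 0) = (x == 0).
Proof. by rewrite -[RHS]normr_eq0 rnormE -(inj_eq (@complexI R)). Qed.

Lemma rnorm_gt0 x : (0 < rnorm x) = (x != 0).
Proof. by rewrite lt_neqAle rnorm_ge0 andbT eq_sym rnorm_eq0. Qed.

Lemma rnormD x y : rnorm (x + y) <= rnorm x + rnorm y.
Proof. by rewrite -lecR rmorphD /= -!rnormE ler_normD. Qed.

Lemma rnormN x : rnorm (- x) = rnorm x.
Proof. by rewrite /rnorm normrN. Qed.

Lemma rnormB x y : rnorm (x - y) <= rnorm x + rnorm y.
Proof. by rewrite -(rnormN y) rnormD. Qed.

Lemma rdistC x y : rnorm (x - y) = rnorm (y - x).
Proof. by rewrite -rnormN opprB. Qed.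

Lemma rnorm_tri x y z : rnorm (x - z) <= rnorm (x - y) + rnorm (y - z).
Proof. by rewrite -[x - z](subrKA y) rnormD. Qed.

Lemma rnorm_sum (I : Type) (r : seq I) (P : pred I) (F : I -> V) :
  rnorm (\sum_(i <- r | P i) F i) <= \sum_(i <- r | P i) rnorm (F i).
Proof.
elim/big_ind2 : _ => [|x a y b xa yb|//]; first by rewrite rnorm0.
by rewrite (le_trans (rnormD _ _))// lerD.
Qed.

End RealNorm.

Section RealNormScalar.
Variable R : realType.
Implicit Types c d : R[i].

Lemma rnormM c d : rnorm (c * d) = rnorm c * rnorm d.
Proof. by apply: (@complexI R); rewrite rmorphM /= -!rnormE normrM. Qed.

Lemma rnorm1 : rnorm (1 : R[i]) = 1.
Proof. by rewrite /rnorm normr1. Qed.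

Lemma rnormV c : rnorm c^-1 = (rnorm c)^-1.
Proof. by apply: (@complexI R); rewrite fmorphV /= -!rnormE normfV. Qed.

Lemma rnorm_conj c : rnorm c^* = rnorm c.
Proof. by rewrite /rnorm norm_conjC. Qed.

Lemma rnorm_real (a : R) : rnorm a%:C = `|a|.
Proof. by rewrite /rnorm normc_def /= expr0n addr0 sqrtr_sqr. Qed.

Lemma rnorm_le_ReIm c : rnorm c <= `|complex.Re c| + `|complex.Im c|.
Proof.
rewrite {1}[c]complexE (le_trans (rnormD _ _))// rnormM rnorm_real.
by rewrite rnorm_real lerD// -[leRHS]mul1r ler_wpM2r// -lecR -rnormE normCi.
Qed.

Lemma rnormZ (V : normedModType R[i]) c (x : V) :
  rnorm (c *: x) = rnorm c * rnorm x.
Proof. by apply: (@complexI R); rewrite rmorphM /= -!rnormE normrZ. Qed.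

Lemma rnorm_scale (V : normedModType R[i]) (a : R) (x : V) :
  rnorm (a%:C *: x) = `|a| * rnorm x.
Proof. by rewrite rnormZ rnorm_real. Qed.

Lemma rnorm_normalize (V : normedModType R[i]) (x : V) : x != 0 ->
  rnorm ((rnorm x)^-1%:C *: x) = 1.
Proof.
by move=> x0; rewrite rnorm_scale normfV ger0_norm ?rnorm_ge0// mulVf// rnorm_eq0.
Qed.

End RealNormScalar.

Section InnerProduct.
Variables (R : realType) (H : completeNormedModType R[i]).
Variable ip : {dot H for (@Num.conj R[i])}.
Hypothesis ipH : hilbert_form ip.
Implicit Types (x y z u : H) (c : R[i]).

Lemma ipC x y : ip x y = (ip y x)^*.
Proof. by rewrite hermC expr0 mul1r. Qed.

Lemma ipZl c x y : ip (c *: x) y = c * ip x y.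
Proof. by rewrite linearZl_LR. Qed.

Lemma ipZr c x y : ip x (c *: y) = c^* * ip x y.
Proof. by rewrite linearZr_LR. Qed.

Lemma ip_eq0C x y : ip x y = 0 -> ip y x = 0.
Proof. by rewrite ipC => /eqP; rewrite fmorph_eq0 => /eqP. Qed.

Lemma rnorm_ipC x y : rnorm (ip x y) = rnorm (ip y x).
Proof. by rewrite ipC rnorm_conj. Qed.

Lemma ipE x : ip x x = (rnorm x ^+ 2)%:C.
Proof. by rewrite -ipH rnormE rmorphXn. Qed.

Lemma rnorm_ip_self x : rnorm (ip x x) = rnorm x ^+ 2.
Proof. by rewrite ipE rnorm_real ger0_norm// sqr_ge0. Qed.

Lemma ip_inj x y : (forall z, ip x z = ip y z) -> x = y.
Proof.
move=> xy; apply/eqP; rewrite -subr_eq0 -rnorm_eq0 -sqrf_eq0.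
by rewrite -rnorm_ip_self linearBl /= xy subrr rnorm0.
Qed.

Lemma pythagoras x y : ip x y = 0 -> rnorm (x + y) ^+ 2 = rnorm x ^+ 2 + rnorm y ^+ 2.
Proof.
move=> xy; apply: (@complexI R); rewrite rmorphD /= -!ipE linearDl !linearDr /=.
by rewrite xy (ip_eq0C xy) addr0 add0r.
Qed.

Lemma cauchy_schwarz x y : rnorm (ip x y) <= rnorm x * rnorm y.
Proof.
have [->|y0] := eqVneq y 0; first by rewrite linear0r !rnorm0 mulr0.
have ny : 0 < rnorm y by rewrite rnorm_gt0.
have nyC : (rnorm y ^+ 2)%:C != 0 :> R[i].
  by rewrite fmorph_eq0 expf_eq0 /= gt_eqF.
(* [t *: y] is the projection of [x] on [y]; by Pythagoras it is no longer than [x], which is the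
   claim up to a factor [rnorm y]. *)
pose t := ip x y / ip y y.
have orth : ip (x - t *: y) (t *: y) = 0.
  by rewrite ipZr linearBl /= ipZl /t divfK ?subrr ?mulr0// ipE.
have := pythagoras orth; rewrite subrK rnormZ => e.
have : rnorm t * rnorm y <= rnorm x.
  rewrite -(@ler_pXn2r _ 2)// ?nnegrE ?mulr_ge0 ?rnorm_ge0//.
  by rewrite e lerDr sqr_ge0.
rewrite /t rnormM rnormV rnorm_ip_self => h.
rewrite -ler_pdivrMr//; move: h; congr (_ <= _).
by rewrite expr2 invfM mulrA divfK// gt_eqF.
Qed.

(** The family is a total sequence of which only the first [n] terms matter, so families can be
    truncated and extended without casting ordinals. *)
Definition ortho (e : nat -> H) (n : nat) :=
  forall i j, (i < n)%N -> (j < n)%N -> ip (e i) (e j) = (i == j)%:R.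

Definition orthoseq (e : nat -> H) := forall i j, ip (e i) (e j) = (i == j)%:R.

Lemma orthoseqW e n : orthoseq e -> ortho e n.
Proof. by move=> oe i j _ _; exact: oe. Qed.

Lemma orthoW e n m : (m <= n)%N -> ortho e n -> ortho e m.
Proof. by move=> mn oe i j im jm; apply: oe; exact: leq_trans mn. Qed.

Lemma ortho_rnorm e n i : ortho e n -> (i < n)%N -> rnorm (e i) = 1.
Proof.
move=> oe ni; apply/eqP; rewrite -sqrp_eq1 ?rnorm_ge0//.
by rewrite -rnorm_ip_self oe// eqxx rnorm1.
Qed.

Lemma orthoseq_rnorm e i : orthoseq e -> rnorm (e i) = 1.
Proof. by move=> oe; apply: (ortho_rnorm (orthoseqW (n := i.+1) oe)). Qed.

Lemma ip_suml (e : nat -> H) n (c : nat -> R[i]) u :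
  ip (\sum_(i < n) c i *: e i) u = \sum_(i < n) c i * ip (e i) u.
Proof. by rewrite linear_sumlz; apply: eq_bigr => i _; rewrite /= ipZl. Qed.

Lemma ip_sum_ortho (e : nat -> H) n (c : nat -> R[i]) j : ortho e n -> (j < n)%N ->
  ip (\sum_(i < n) c i *: e i) (e j) = c j.
Proof.
move=> oe jn; rewrite ip_suml (bigD1 (Ordinal jn))//= oe// eqxx mulr1.
rewrite big1 ?addr0// => i; rewrite -val_eqE /= => ij.
by rewrite oe// (negPf ij) mulr0.
Qed.

Lemma rnorm_sum_ortho (e : nat -> H) n (c : nat -> R[i]) : ortho e n ->
  rnorm (\sum_(i < n) c i *: e i) ^+ 2 = \sum_(i < n) rnorm (c i) ^+ 2.
Proof.
elim: n => [_|n IH oe]; first by rewrite !big_ord0 rnorm0 expr0n.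
rewrite !big_ord_recr /= pythagoras; last first.
  rewrite ip_suml big1// => i _; rewrite ipZr oe ?ltnS//; last exact: ltnW.
  by rewrite ltn_eqF// !mulr0.
rewrite IH; last exact: orthoW oe.
by rewrite rnormZ (ortho_rnorm oe)// mulr1.
Qed.

Definition proj (e : nat -> H) n u := \sum_(i < n) ip u (e i) *: e i.

Lemma proj_ortho e n u j : ortho e n -> (j < n)%N -> ip (u - proj e n u) (e j) = 0.
Proof. by move=> oe jn; rewrite linearBl /= (ip_sum_ortho (fun i => ip u (e i)) oe)// subrr. Qed.

Lemma rnorm_proj e n u : ortho e n ->
  rnorm (proj e n u) ^+ 2 = \sum_(i < n) rnorm (ip u (e i)) ^+ 2.
Proof. by move=> oe; rewrite /proj (rnorm_sum_ortho (fun i => ip u (e i)) oe). Qed.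

Lemma pythagoras_proj e n u : ortho e n ->
  rnorm u ^+ 2 = rnorm (u - proj e n u) ^+ 2 + rnorm (proj e n u) ^+ 2.
Proof.
move=> oe; rewrite -pythagoras ?subrK// {2}/proj linear_sumr /= big1// => i _.
by rewrite ipZr proj_ortho ?mulr0.
Qed.

Lemma bessel e n u : ortho e n ->
  \sum_(i < n) rnorm (ip u (e i)) ^+ 2 <= rnorm u ^+ 2.
Proof.
by move=> oe; rewrite -rnorm_proj// (pythagoras_proj u oe) lerDr sqr_ge0.
Qed.

Lemma rnorm_sub_proj_le e n u : ortho e n -> rnorm (u - proj e n u) <= rnorm u.
Proof.
move=> oe; rewrite -(@ler_pXn2r _ 2)// ?nnegrE ?rnorm_ge0//.
by rewrite (pythagoras_proj u oe) lerDl sqr_ge0.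
Qed.

End InnerProduct.

(** * Linear maps and finite orthonormalization *)

(** Dependent choice in which a term may depend on all earlier ones, and its existence may rely on
    their having been chosen well. It drives every greedy construction below. *)
Lemma history_choice (T : pointedType) (P : seq T -> T -> Prop) :
  (forall f n, (forall i, (i < n)%N -> P (mkseq f i) (f i)) ->
    exists t, P (mkseq f n) t) ->
  exists f : nat -> T, forall n, P (mkseq f n) (f n).
Proof.
move=> h.
(* [next] is total: it takes the value [point] on histories that cannot be continued, which the
   induction shows never to arise. *)
have [next nextP] : {next : seq T -> T & forall s, (exists t, P s t) -> P s (next s)}.
  apply: (@choice _ _ (fun s t => (exists t, P s t) -> P s t)) => s.
  by have [[t st]|nt] := pselect (exists t, P s t); [exists t|exists point].
pose S n := iter n (fun s => rcons s (next s)) [::].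
have SE n : mkseq (fun k => next (S k)) n = S n.
  by elim: n => // n IH; rewrite mkseqS IH.
exists (fun n => next (S n)); elim/ltn_ind => n IH.
by have := h _ _ IH; rewrite SE; exact: nextP.
Qed.

Section LinearMaps.
Variables (R : realType) (H : completeNormedModType R[i]).
Variable T : H -> H.
Hypothesis linT : linear T.

Lemma linD x y : T (x + y) = T x + T y.
Proof. by have := linT 1 x y; rewrite !scale1r. Qed.

Lemma lin0 : T 0 = 0.
Proof. by apply: (addrI (T 0)); rewrite -linD !addr0. Qed.

Lemma linZ c x : T (c *: x) = c *: T x.
Proof. by have := linT c x 0; rewrite lin0 !addr0. Qed.

Lemma linB x y : T (x - y) = T x - T y.
Proof. by rewrite -scaleN1r linD linZ scaleN1r. Qed.

Lemma lin_sum (I : Type) (r : seq I) (P : pred I) (F : I -> H) :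
  T (\sum_(i <- r | P i) F i) = \sum_(i <- r | P i) T (F i).
Proof. by elim/big_ind2 : _ => [|x a y b <- <-|//]; rewrite ?lin0 ?linD. Qed.

End LinearMaps.

Definition bounded_by (R : realType) (H : completeNormedModType R[i])
  (M : R) (T : H -> H) := forall u, rnorm (T u) <= M * rnorm u.

Lemma bounded_of_ball (R : realType) (H : completeNormedModType R[i])
    (M : R) (T : H -> H) : linear T ->
  (forall u, rnorm u <= 1 -> rnorm (T u) <= M) -> bounded_by M T.
Proof.
move=> linT h u; have [->|u0] := eqVneq u 0; first by rewrite lin0// !rnorm0 mulr0.
have nu : 0 < rnorm u by rewrite rnorm_gt0.
have := h ((rnorm u)^-1%:C *: u).
rewrite rnorm_normalize// linZ// => /(_ (lexx _)).
by rewrite rnorm_scale normfV (ger0_norm (ltW nu)) mulrC ler_pdivrMr.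
Qed.

Section FiniteDimension.
Variables (R : realType) (H : completeNormedModType R[i]).
Variable ip : {dot H for (@Num.conj R[i])}.
Hypothesis ipH : hilbert_form ip.

(** Each vector of [s] contributes its normalized remainder modulo the previous ones, unless that
    remainder is zero. The equation [x = proj ip e n x] expresses membership in the span. *)
Lemma gram_schmidt (s : seq H) :
  exists n e, ortho ip e n /\ forall x, x \in s -> x = proj ip e n x.
Proof.
elim: s => [|x s [n [e [oe se]]]]; first by exists 0%N, (fun=> 0).
have [r0|r0] := eqVneq (x - proj ip e n x) 0.
  exists n, e; split => // z; rewrite inE => /orP[/eqP ->|/se//].
  by apply/eqP; rewrite -subr_eq0 r0.
set r := x - _ in r0; have nr : 0 < rnorm r by rewrite rnorm_gt0.
pose g := (rnorm r)^-1%:C *: r.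
have rg j : (j < n)%N -> ip r (e j) = 0 by exact: proj_ortho.
have gg : ip g g = 1.
  by rewrite (ipE ipH) rnorm_normalize// expr1n.
have ge j : (j < n)%N -> ip g (e j) = 0 by move=> jn; rewrite ipZl rg// mulr0.
pose e' i := if (i < n)%N then e i else g.
have prE u : proj ip e' n.+1 u = proj ip e n u + ip u g *: g.
  rewrite /proj big_ord_recr /= {3 4}/e' ltnn; congr (_ + _).
  by apply: eq_bigr => i _; rewrite /e' ltn_ord.
have pg z : ip (proj ip e n z) g = 0.
  rewrite /proj (ip_suml _ _ _ (fun i => ip z (e i))) big1// => i _.
  by rewrite (@ip_eq0C _ _ _ g) ?mulr0// ge.
exists n.+1, e'; split.
  move=> i j; rewrite /e' !ltnS (leq_eqVlt i) (leq_eqVlt j).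
  have [-> _|ni /= ltin] := eqVneq i n.
    have [-> _|nj /= ltjn] := eqVneq j n; first by rewrite ltnn gg.
    by rewrite ltnn ltjn ge.
  have [-> _|nj /= ltjn] := eqVneq j n.
    by rewrite ltnn ltin (negPf ni); apply: ip_eq0C; exact: ge.
  by rewrite ltin ltjn oe.
move=> z; rewrite inE prE => /orP[/eqP ->|zs]; last first.
  by rewrite {3}(se z zs) pg scale0r addr0 -se.
have -> : ip x g *: g = r; last by rewrite addrC subrK.
have xE : x = r + proj ip e n x by rewrite subrK.
have -> : ip x g = (rnorm r)%:C.
  rewrite {1}xE linearDl /= pg addr0 ipZr (ipE ipH).
  by rewrite [_^*]conjc_real -rmorphM /= expr2 mulKf ?gt_eqF.
by rewrite /g scalerA -rmorphM /= mulfV ?gt_eqF// scale1r.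
Qed.

Lemma ortho_free (e : nat -> H) n (c : nat -> R[i]) : ortho ip e n ->
  \sum_(i < n) c i *: e i = 0 -> forall i, (i < n)%N -> c i = 0.
Proof. by move=> oe s0 i ni; rewrite -(ip_sum_ortho c oe ni) s0 linear0l. Qed.

Definition perp (s : seq H) (u : H) := forall x, x \in s -> ip u x = 0.

Lemma perp_proj_sum (e : nat -> H) n u x :
  (forall i, (i < n)%N -> ip u (e i) = 0) -> x = proj ip e n x -> ip u x = 0.
Proof.
move=> ue ->; rewrite linear_sumr /= big1// => i _.
by rewrite ipZr ue ?mulr0.
Qed.

(** If [proj ip e n] fixed every vector, the [n] orthonormal vectors spanning [s] would be a basis
    of [H]. Otherwise a nonzero remainder is normalized. *)
Lemma exists_unit_perp (s : seq H) : infinite_dimensional H ->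
  exists2 u, rnorm u = 1 & perp s u.
Proof.
move=> infH; have [n [e [oe se]]] := gram_schmidt s.
have [x xe] : exists x, x - proj ip e n x != 0.
  apply: contrapT => /forallNP h; apply: (infH n).
  exists (fun i => e i); split.
    move=> c c0 i; pose c' k := if insub k is Some j then c j else 0.
    have c'E (j : 'I_n) : c' j = c j by rewrite /c' valK.
    rewrite -c'E; apply: (ortho_free oe) => //.
    by rewrite -[RHS]c0; apply: eq_bigr => j _; rewrite c'E.
  apply/seteqP; split => // x _; exists (fun i => ip x (e i)).
  by apply/eqP; rewrite -subr_eq0; apply/negPn/negP; exact: h.
exists ((rnorm (x - proj ip e n x))^-1%:C *: (x - proj ip e n x)).
  exact: rnorm_normalize.
move=> z /se; apply: perp_proj_sum => i ni.
by rewrite ipZl proj_ortho ?mulr0.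
Qed.

Lemma orthoseq_of_perp (e : nat -> H) :
  (forall n, rnorm (e n) = 1) -> (forall n, perp (mkseq e n) (e n)) -> orthoseq ip e.
Proof.
move=> e1 ep i j; have lt k l : (k < l)%N -> ip (e l) (e k) = 0.
  by move=> kl; apply: ep; apply/mapP; exists k => //; rewrite mem_iota.
have [ij|ji|->] := ltngtP i j; last by rewrite (ipE ipH) e1 expr1n.
- by rewrite ip_eq0C// lt.
- by rewrite lt.
Qed.

Lemma exists_orthoseq : infinite_dimensional H -> exists e, orthoseq ip e.
Proof.
move=> infH.
have [|e he] := @history_choice H (fun s u => rnorm u = 1 /\ perp s u).
  by move=> f n _; have [u u1 us] := exists_unit_perp (mkseq f n) infH; exists u.
by exists e; apply: orthoseq_of_perp => n; apply he.
Qed.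

End FiniteDimension.

(** * Precompact sets and compact operators *)

Section Topology.
Variables (R : realType) (H : completeNormedModType R[i]).
Implicit Types (x y z : H) (A : set H).

Lemma ballRE x (e : R) : ball x e%:C = [set y | rnorm (x - y) < e].
Proof.
rewrite -ball_normE; apply/funext => y /=; apply/propext.
by rewrite /ball_ /= rnormE ltcR.
Qed.

Lemma gt0C_real (e : R[i]) : 0 < e -> exists2 r : R, 0 < r & e = r%:C.
Proof.
move=> e0; have : e \is Num.real by rewrite gtr0_real.
by move=> /RRe_real eE; exists (complex.Re e); rewrite ?eE// -ltcR eE.
Qed.

Lemma nbhs_rnorm x (e : R) : 0 < e -> nbhs x [set y | rnorm (x - y) < e].
Proof.
by move=> e0; rewrite -ballRE; apply: nbhsx_ballx; rewrite ltcR.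
Qed.

Definition tot_bounded A := forall e : R, 0 < e ->
  exists s : seq H, forall x, A x -> exists2 y, y \in s & rnorm (x - y) < e.

(** An ultrafilter contains the ball around the head of [s] or its complement; in the second case
    the remaining balls still cover a member of [F]. *)
Lemma ultra_cover (F : set_system H) (s : seq H) (e : R) A : UltraFilter F -> F A ->
  (forall x, A x -> exists2 y, y \in s & rnorm (x - y) < e) ->
  exists2 y, y \in s & F [set x | rnorm (x - y) < e].
Proof.
move=> UF; elim: s A => [|y s IH] A FA As.
  by have [x /As[]] := filter_ex FA.
have [Fy|Fy] := in_ultra_setVsetC [set x | rnorm (x - y) < e] UF.
  by exists y => //; rewrite inE eqxx.
have [|x [/As[z + xz] /= xy]|z zs Fz] := IH (A `&` ~` [set x | rnorm (x - y) < e]).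
- exact: filterI.
- by rewrite inE => /orP[/eqP zy|]; [move: xy; rewrite -zy xz|exists z].
- by exists z => //; rewrite inE zs orbT.
Qed.

Lemma tot_bounded_closure A : tot_bounded A -> tot_bounded (closure A).
Proof.
move=> tA e e0; have e20 : 0 < e / 2 by rewrite divr_gt0.
have [s sA] := tA _ e20; exists s => x /(_ _ (nbhs_rnorm x e20))[y [/sA[z zs yz] /= xy]].
by exists z => //; rewrite (le_lt_trans (rnorm_tri x y z))// (splitr e) ltrD.
Qed.

(** By [ultra_cover] an ultrafilter on the closure contains arbitrarily small balls, so it is Cauchy
    and converges by completeness of [H]. *)
Lemma tot_bounded_precompact A : tot_bounded A -> precompact A.
Proof.
move=> /tot_bounded_closure tA; rewrite precompactE compact_ultra => F UF FA.
have : cauchy F.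
  apply: cauchy_exP => e' /gt0C_real[e e0 ->]; have [s sA] := tA e e0.
  have [y ys Fy] := ultra_cover UF FA sA; exists y; rewrite ballRE.
  by apply: filterS Fy => x /=; rewrite rdistC.
move=> /cauchy_cvg/cvg_ex[l Fl]; exists l; split => //.
exact: (@closed_cvg _ _ F _ id (closure A) (@closed_closure _ A) FA l Fl).
Qed.

(** Cluster points in this form replace convergent subsequences throughout. *)
Lemma precompact_cluster A (z : nat -> H) : precompact A -> (forall n, A (z n)) ->
  exists l, forall (e : R) N, 0 < e -> exists2 n, (N <= n)%N & rnorm (z n - l) < e.
Proof.
rewrite precompactE => cA zA.
have [|l [_ zl]] := cA (z @ \oo) _; first by exists 0%N => // n _; apply: subset_closure; exact: zA.
exists l => e N e0.
have zN : (z @ \oo) (z @` [set n | (N <= n)%N]) by exists N => // n /= Nn; exists n.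
have [x [[n /= Nn <-] /= nl]] := zl _ _ zN (nbhs_rnorm l e0).
by exists n => //; rewrite rdistC.
Qed.

Lemma precompact_bounded A : precompact A -> exists2 M : R, 0 <= M & forall x, A x -> rnorm x <= M.
Proof.
move=> cA; apply: contrapT => nb.
have [z zP] : {z : nat -> H & forall n : nat, A (z n) /\ n%:R < rnorm (z n)}.
  apply: (@choice _ _ (fun n x => A x /\ n%:R < rnorm x)) => n.
  apply: contrapT => /forallNP h; apply: nb; exists n%:R => // x Ax.
  by rewrite leNgt; apply/negP => nx; apply: (h x).
have [l lz] := precompact_cluster cA (fun n => (zP n).1).
have [n Nn nl] := lz 1 (Num.truncn (rnorm l + 1)).+1 ltr01.
have zl : rnorm (z n) <= rnorm l + 1.
  by rewrite -[z n](subrK l) (le_trans (rnormD _ _))// addrC lerD2l ltW.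
have := (zP n).2; rewrite ltNge => /negP; apply; apply: (le_trans zl).
by apply: (le_trans (ltW (truncnS_gt _))); rewrite ler_nat.
Qed.

End Topology.

Section ComplexGrid.
Variable R : realType.

Lemma real_grid (C d : R) : 0 <= C -> 0 < d ->
  exists s : seq R, forall r, `|r| <= C -> exists2 g, g \in s & `|r - g| < d.
Proof.
move=> C0 d0; pose N := (Num.truncn ((C + C) / d)).+1.
exists [seq k%:R * d - C | k <- iota 0 N] => r; rewrite ler_norml => /andP[Cr rC].
have q0 : 0 <= (r + C) / d by rewrite divr_ge0 ?(ltW d0)// -lerBlDr sub0r.
exists ((Num.truncn ((r + C) / d))%:R * d - C).
  apply/mapP; exists (Num.truncn ((r + C) / d)) => //; rewrite mem_iota add0n /=.
  by rewrite ltnS le_truncn// ler_pM2r ?invr_gt0// lerD2r.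
have /andP[] := truncn_itv q0; rewrite ler_pdivlMr// ltr_pdivrMr// => h1 h2.
rewrite opprB addrA ger0_norm ?subr_ge0//.
by rewrite ltrBlDl; move: h2; rewrite -natr1 mulrDl mul1r.
Qed.

Lemma complex_grid (C d : R) : 0 <= C -> 0 < d ->
  exists s : seq R[i], forall c, rnorm c <= C -> exists2 g, g \in s & rnorm (c - g) < d.
Proof.
move=> C0 d0; have [s sP] := real_grid C0 (divr_gt0 d0 (@ltr0Sn R 1)).
exists [seq x +i* y | x <- s, y <- s] => c cC.
have leC : `|complex.Re c| <= C /\ `|complex.Im c| <= C.
  split; apply: le_trans cC; rewrite /rnorm normc_def /= -sqrtr_sqr ler_wsqrtr//.
    by rewrite lerDl sqr_ge0.
  by rewrite lerDr sqr_ge0.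
have [[x xs cx] [y ys cy]] := (sP _ leC.1, sP _ leC.2).
exists (x +i* y); first by apply/allpairsP; exists (x, y).
rewrite (le_lt_trans (rnorm_le_ReIm _))// (splitr d); case: c cx cy {cC leC} => a b /=.
by move=> *; rewrite ltrD.
Qed.

End ComplexGrid.

Section CompactOperators.
Variables (R : realType) (H : completeNormedModType R[i]).
Variable ip : {dot H for (@Num.conj R[i])}.
Hypothesis ipH : hilbert_form ip.

Lemma tot_bounded_comb (g : nat -> H) n :
  tot_bounded [set x | exists2 c : nat -> R[i], (forall i, rnorm (c i) <= 1) &
                        x = \sum_(i < n) c i *: g i].
Proof.
elim: n => [|n IH] e e0.
  exists [:: 0] => x [c _ ->]; exists 0; first by rewrite inE.
  by rewrite big_ord0 subrr rnorm0.
have e20 : 0 < e / 2 by rewrite divr_gt0.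
have g0 : 0 < rnorm (g n) + 1 by rewrite ltr_wpDl// rnorm_ge0.
have [s sP] := IH _ e20.
have [t tP] := complex_grid (@ler01 R) (divr_gt0 e20 g0).
exists [seq x + c *: g n | x <- s, c <- t] => x [c c1 ->]; rewrite big_ord_recr /=.
have [|y ys hy] := sP (\sum_(i < n) c i *: g i); first by exists c.
have [d dt hd] := tP _ (c1 n).
exists (y + d *: g n); first by apply/allpairsP; exists (y, d).
rewrite opprD addrACA -scalerBl (le_lt_trans (rnormD _ _))// (splitr e) ltrD//.
rewrite rnormZ; move: hd; rewrite ltr_pdivlMr//; apply: le_lt_trans.
by rewrite ler_wpM2l ?rnorm_ge0// lerDl.
Qed.

Definition small_off (T : H -> H) (e : R) (s : seq H) :=
  forall u, perp ip s u -> rnorm (T u) <= e * rnorm u.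

(** Splitting [u] into its projection on the span of [s] and the rest, the image of the unit ball
    stays close to a bounded set of combinations of finitely many vectors, which is totally
    bounded. *)
Lemma compact_of_small_off (T : H -> H) : linear T ->
  (forall e, 0 < e -> exists s, small_off T e s) -> compact_operator T.
Proof.
move=> linT sT; split => //; apply: tot_bounded_precompact => d d0.
have d20 : 0 < d / 2 by rewrite divr_gt0.
(* A quarter rather than a half, because [small_off] is a weak inequality and the total error must
   be strictly below [d]. *)
have d40 : 0 < d / 2 / 2 by rewrite divr_gt0.
have [s sP] := sT _ d40; have [n [e [oe se]]] := gram_schmidt ipH s.
have [t tP] := tot_bounded_comb (T \o e) n d20.
exists t => x [u] /=; rewrite rnormE lecR => u1 <-.
have [|y yt hy] := tP (T (proj ip e n u)).
  rewrite /proj lin_sum//; under eq_bigr do rewrite linZ//.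
  exists (fun i => if (i < n)%N then ip u (e i) else 0).
    move=> i; case: ifPn => ni; last by rewrite rnorm0.
    by rewrite (le_trans (cauchy_schwarz ipH _ _))// (ortho_rnorm ipH oe)// mulr1.
  by apply: eq_bigr => i _; rewrite ltn_ord.
exists y => //; rewrite (le_lt_trans (rnorm_tri _ (T (proj ip e n u)) _))//.
rewrite (splitr d) ltrD// -linB// (@le_lt_trans _ _ (d / 2 / 2))//; last first.
  by rewrite ltr_pdivrMr// ltr_pMr// ltr1n.
apply: le_trans (sP _ _) _.
  by move=> z /se; apply: perp_proj_sum => i ni; exact: proj_ortho.
by rewrite ler_piMr ?(ltW d40)// (le_trans _ u1)// (rnorm_sub_proj_le ipH).
Qed.

Lemma compact_bounded_by (T : H -> H) : compact_operator T ->
  exists2 M, 0 <= M & bounded_by M T.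
Proof.
move=> [linT /precompact_bounded[M M0 MT]]; exists M => //.
by apply: bounded_of_ball => // u u1; apply: MT; exists u => //=; rewrite rnormE lecR.
Qed.

Definition rank_one (h eta : H) : H -> H := fun z => ip z eta *: h.

Lemma rank_one_compact h eta : compact_operator (rank_one h eta).
Proof.
apply: compact_of_small_off => [c x y|e e0].
  by rewrite /rank_one linearDl /= ipZl scalerDl scalerA.
exists [:: eta] => u ue; rewrite /rank_one ue ?inE// scale0r rnorm0.
by rewrite mulr_ge0 ?rnorm_ge0// ltW.
Qed.

(** Compactness supplies the upper bound without which the [sup] in [opnorm] carries no
    information. *)
Lemma opnorm_ub (T : H -> H) u : compact_operator T -> rnorm u <= 1 ->
  rnorm (T u) <= opnorm T.
Proof.
move=> cT u1; have [M M0 TM] := compact_bounded_by cT.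
apply: ub_le_sup; last by exists u => //=; rewrite rnormE lecR.
exists M => _ [v + <-]; rewrite /= rnormE lecR => v1.
by rewrite (le_trans (TM v))// ler_piMr.
Qed.

Lemma opnorm_le (T : H -> H) (M : R) : 0 <= M -> bounded_by M T -> opnorm T <= M.
Proof.
move=> M0 TM; apply: ge_sup.
  by exists (rnorm (T 0)), 0 => //=; rewrite normr0.
move=> _ [v + <-]; rewrite /= rnormE lecR => v1.
by rewrite (le_trans (TM v))// ler_piMr.
Qed.

End CompactOperators.

(** * Adjoints and norm-maximizing vectors *)

(** The limit arguments below leave an error [K * e] with [K] fixed, possibly zero; hence the
    division by [K + 1]. *)
Lemma ler_epsM (R : realType) (K x y : R) : 0 <= K ->
  (forall e, 0 < e -> x <= y + K * e) -> x <= y.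
Proof.
move=> K0 h; apply/ler_addgt0Pr => e e0.
have K1 : 0 < K + 1 by rewrite ltr_wpDl.
apply: (le_trans (h _ (divr_gt0 e0 K1))).
by rewrite lerD2l mulrA ler_pdivrMr// mulrC ler_pM2l// lerDl.
Qed.

Section Adjoint.
Variables (R : realType) (H : completeNormedModType R[i]).
Variable ip : {dot H for (@Num.conj R[i])}.
Hypothesis ipH : hilbert_form ip.
Variables T T' : H -> H.
Hypothesis adj : is_adjoint ip T T'.

Lemma is_adjoint_sym : is_adjoint ip T' T.
Proof. by move=> x y; rewrite ipC -adj -ipC. Qed.

(** [is_adjoint] asks only for the identity; linearity of [T'] follows because the form separates
    points. *)
Lemma adjoint_linear : linear T'.
Proof.
move=> c x y; apply: (ip_inj ipH) => z.
by rewrite linearDl /= ipZl !is_adjoint_sym linearDl /= ipZl.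
Qed.

(** The square of [rnorm (T' y)] is [<T (T' y), y>]; Cauchy-Schwarz and one cancellation give the
    bound. *)
Lemma adjoint_bounded M : bounded_by M T -> bounded_by M T'.
Proof.
move=> TM y; have [->|n0] := eqVneq (rnorm (T' y)) 0.
  have := TM y; have [->|y0] := eqVneq y 0.
    by rewrite !rnorm0 mulr0.
  by move=> h; rewrite (le_trans _ h)// rnorm_ge0.
have np : 0 < rnorm (T' y) by rewrite lt_neqAle eq_sym n0 rnorm_ge0.
rewrite -(ler_pM2l np) -expr2 -(rnorm_ip_self ipH) -adj.
apply: (le_trans (cauchy_schwarz ipH _ _)).
by rewrite mulrA ler_wpM2r ?rnorm_ge0// mulrC TM.
Qed.

Lemma adjoint_ip x y : ip (T' (T x)) y = ip (T x) (T y).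
Proof. exact: is_adjoint_sym. Qed.

Lemma adjoint_ip' x y : ip x (T' (T y)) = ip (T x) (T y).
Proof. by rewrite adj. Qed.

Lemma adjoint_ip_self x : ip (T' (T x)) x = (rnorm (T x) ^+ 2)%:C.
Proof. by rewrite adjoint_ip (ipE ipH). Qed.

End Adjoint.

Section Greedy.
Variables (R : realType) (H : completeNormedModType R[i]).
Variable ip : {dot H for (@Num.conj R[i])}.
Hypothesis ipH : hilbert_form ip.
Hypothesis infH : infinite_dimensional H.
Variables T T' : H -> H.
Hypothesis cT : compact_operator T.
Hypothesis adj : is_adjoint ip T T'.

Let linT : linear T := cT.1.
Let linT' : linear T' := adjoint_linear ipH adj.

(** The orthogonal complement of eigenvectors of [T' \o T] is invariant under [T' \o T], so
    maximization can continue inside it. *)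
Lemma perp_normal_eigen s x u : perp ip s u -> x \in s ->
  (exists mu, T' (T x) = mu *: x) -> ip (T' (T u)) x = 0.
Proof.
by move=> us xs [mu e]; rewrite (adjoint_ip adj) -(adjoint_ip' adj) e ipZr us ?mulr0.
Qed.

(** Almost maximizing vectors are almost eigenvectors: expand the square on the left and bound
    [rnorm (T' (T u))] by [sigma * rnorm (T u)]. *)
Lemma maximizer_eigen_defect (s : seq H) (sigma : R) u :
  0 <= sigma -> (forall x, x \in s -> exists mu, T' (T x) = mu *: x) ->
  (forall v, perp ip s v -> rnorm (T v) <= sigma * rnorm v) ->
  perp ip s u -> rnorm u <= 1 ->
  rnorm (T' (T u) - (sigma ^+ 2)%:C *: u) ^+ 2 <=
    sigma ^+ 2 * (sigma ^+ 2 - rnorm (T u) ^+ 2).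
Proof.
move=> s0 eig smax us u1; set a := rnorm (T u).
(* [T' (T u)] is again orthogonal to [s], so [sigma] also bounds [T] on it. *)
have Au : rnorm (T' (T u)) <= sigma * a.
  have [->|n0] := eqVneq (rnorm (T' (T u))) 0; first by rewrite mulr_ge0 ?rnorm_ge0.
  have np : 0 < rnorm (T' (T u)) by rewrite lt_neqAle eq_sym n0 rnorm_ge0.
  rewrite -(ler_pM2l np) -expr2 -(rnorm_ip_self ipH) (adjoint_ip adj).
  apply: (le_trans (cauchy_schwarz ipH _ _)).
  rewrite mulrC mulrA ler_wpM2r ?rnorm_ge0// mulrC.
  by apply: smax => x xs; exact: perp_normal_eigen us xs (eig _ xs).
have -> : rnorm (T' (T u) - (sigma ^+ 2)%:C *: u) ^+ 2 =
    rnorm (T' (T u)) ^+ 2 - (sigma ^+ 2) * a ^+ 2 *+ 2 + sigma ^+ 4 * rnorm u ^+ 2.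
  apply: (@complexI R); rewrite -(ipE ipH) linearBl !linearBr /= !ipZl !ipZr.
  rewrite (adjoint_ip_self ipH adj) (adjoint_ip' adj u) !(ipE ipH) [_^*]conjc_real.
  rewrite -/a !rmorphD /= rmorphN rmorphMn !rmorphM /=; ring.
have := rnorm_ge0 (T' (T u)); have := rnorm_ge0 u; have a0 := rnorm_ge0 (T u).
move=> un An.
have h1 : rnorm (T' (T u)) ^+ 2 <= sigma ^+ 2 * a ^+ 2.
  by rewrite -exprMn ler_pXn2r ?nnegrE// mulr_ge0.
have h2 : sigma ^+ 4 * rnorm u ^+ 2 <= sigma ^+ 4.
  by rewrite ler_piMr ?exprn_ge0// exprn_ile1.
have e4 : sigma ^+ 4 = sigma ^+ 2 * sigma ^+ 2 by rewrite -exprD.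
by move: h1 h2; rewrite e4 mulrBr; lra.
Qed.

(** The supremum [sigma] is attained without weak compactness: for a maximizing sequence, [T (u n)]
    clusters at some [l] by compactness of [T], and [u n], being close to [sigma^-2 T' (T (u n))],
    clusters at [sigma^-2 T' l]. *)
Lemma exists_maximizer (s : seq H) :
  (forall x, x \in s -> exists mu, T' (T x) = mu *: x) ->
  exists t, [/\ rnorm t = 1, perp ip s t,
    T' (T t) = (rnorm (T t) ^+ 2)%:C *: t &
    forall u, perp ip s u -> rnorm (T u) <= rnorm (T t) * rnorm u].
Proof.
move=> eig; have [M M0 TM] := compact_bounded_by cT.
have T'M := adjoint_bounded ipH adj TM.
pose E := [set r | exists u, [/\ perp ip s u, rnorm u <= 1 & r = rnorm (T u)]].
have E0 : E 0.
  exists 0; rewrite lin0// !rnorm0; split => //.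
  by move=> x _; rewrite linear0l.
have supE : has_sup E.
  split; first by exists 0.
  exists M => _ [u [us u1 ->]]; apply: (le_trans (TM u)); exact: ler_piMr.
pose sigma := sup E.
have s0 : 0 <= sigma by apply: ub_le_sup => //; exact: supE.2.
have smax v : perp ip s v -> rnorm (T v) <= sigma * rnorm v.
  move=> vs; have [->|v0] := eqVneq v 0; first by rewrite lin0// !rnorm0 mulr0.
  have nv : 0 < rnorm v by rewrite rnorm_gt0.
  rewrite -ler_pdivrMr// mulrC; apply: ub_le_sup; first exact: supE.2.
  exists ((rnorm v)^-1%:C *: v); split; first by move=> x xs; rewrite ipZl vs ?mulr0.
    by rewrite rnorm_normalize.
  by rewrite linZ// rnorm_scale normfV (ger0_norm (ltW nv)).
(* If [sigma] is zero, [T] vanishes on the complement and any unit vector there will do. *)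
have [sp|sn] := ltP 0 sigma; last first.
  have [t t1 ts] := exists_unit_perp ipH s infH; exists t.
  have z u : perp ip s u -> T u = 0.
    move=> /smax us; apply/eqP; rewrite -rnorm_eq0 eq_le rnorm_ge0 andbT.
    by apply: (le_trans us); rewrite mulr_le0_ge0 ?rnorm_ge0.
  split => //; first by rewrite z// lin0// rnorm0 expr0n scale0r.
  by move=> u us; rewrite !z// rnorm0 mul0r.
have [u uP] : {u : nat -> H & forall n : nat,
    [/\ perp ip s (u n), rnorm (u n) <= 1 & sigma - n.+1%:R^-1 < rnorm (T (u n))]}.
  apply: (@choice _ _ (fun n u => [/\ perp ip s u, rnorm u <= 1 &
    sigma - n.+1%:R^-1 < rnorm (T u)])) => n.
  have n0 : 0 < n.+1%:R^-1 :> R by rewrite invr_gt0.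
  by have [_ [u [us u1 ->]] h] := sup_adherent n0 supE; exists u.
have [|l lP] := precompact_cluster (z := T \o u) cT.2.
  by move=> n; exists (u n) => //=; rewrite rnormE lecR; have [] := uP n.
pose t := (sigma ^- 2)%:C *: T' l.
have s2 : 0 < sigma ^+ 2 by rewrite exprn_gt0.
have close e : 0 < e -> exists v,
    [/\ perp ip s v, rnorm v <= 1, sigma - e <= rnorm (T v) & rnorm (v - t) <= e].
  move=> e0; pose k := e * sigma ^+ 2 / 2.
  have k0 : 0 < k by rewrite divr_gt0// mulr_gt0.
  have s3 : 0 < sigma ^+ 3 *+ 2 by rewrite pmulrn_lgt0// exprn_gt0.
  have M1 : 0 < M + 1 by rewrite ltr_wpDl.
  (* The second bound keeps the eigenvector defect below [k], the third keeps [T' (T (u n))] within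
     [k] of [T' l]. The two errors add up to [e * sigma ^+ 2], and dividing by [sigma ^+ 2] leaves
     [e]. *)
  pose d := Num.min (Num.min e (k ^+ 2 / (sigma ^+ 3 *+ 2))) (k / (M + 1)).
  have d0 : 0 < d.
    by rewrite !lt_min e0 /=; apply/andP; split; apply: divr_gt0 => //; exact: exprn_gt0.
  have de : d <= e by rewrite !ge_min lexx.
  have dk : d * (sigma ^+ 3 *+ 2) <= k ^+ 2.
    by rewrite -ler_pdivlMr// !ge_min lexx orbT.
  have dM : (M + 1) * d <= k by rewrite mulrC -ler_pdivlMr// !ge_min lexx orbT.
  have [n Nn nl] := lP d (Num.truncn d^-1).+1 d0.
  have [us u1 un] := uP n; exists (u n).
  have ud : sigma - d <= rnorm (T (u n)).
    apply: le_trans (ltW un); rewrite lerD2l lerN2.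
    rewrite -[leRHS]invrK lef_pV2 ?posrE ?invr_gt0//.
    apply: (le_trans (ltW (truncnS_gt _))); rewrite ler_nat.
    exact: (leq_trans Nn).
  split => //; first by apply: le_trans ud; rewrite lerD2l lerN2.
  have Tus : rnorm (T (u n)) <= sigma by apply: (le_trans (smax _ us)); rewrite ler_piMr.
  have h1 : rnorm (T' (T (u n)) - (sigma ^+ 2)%:C *: u n) <= k.
    rewrite -(@ler_pXn2r _ 2)// ?nnegrE ?rnorm_ge0 ?(ltW k0)//.
    apply: (le_trans (maximizer_eigen_defect s0 eig smax us u1)); apply: le_trans dk.
    have : sigma ^+ 2 - rnorm (T (u n)) ^+ 2 <= d * (sigma *+ 2).
      rewrite subr_sqr ler_pM ?subr_ge0//; first by rewrite addr_ge0 ?rnorm_ge0.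
        by rewrite lerBlDl addrC -lerBlDl.
      by rewrite mulr2n lerD2l.
    move=> /(ler_wpM2l (ltW s2)) /le_trans; apply.
    by rewrite le_eqVlt; apply/orP; left; apply/eqP; ring.
  have h2 : rnorm (T' (T (u n)) - T' l) <= k.
    rewrite -linB// (le_trans (T'M _))// (le_trans _ dM)// ler_pM ?rnorm_ge0//.
      by rewrite lerDl.
    exact: ltW.
  have tE : T' l = (sigma ^+ 2)%:C *: t.
    by rewrite /t scalerA -rmorphM /= mulfV ?gt_eqF// scale1r.
  rewrite tE in h2.
  have : rnorm ((sigma ^+ 2)%:C *: (u n - t)) <= k + k.
    rewrite scalerBr (le_trans (rnorm_tri _ (T' (T (u n))) _))// lerD//.
    by rewrite rdistC.
  rewrite rnorm_scale (ger0_norm (ltW s2)) -splitr mulrC ler_pM2r//.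
have ts : perp ip s t.
  move=> x xs; apply/eqP; rewrite -rnorm_eq0 eq_le rnorm_ge0 andbT.
  apply: (ler_epsM (rnorm_ge0 x)) => e /close[v [vs _ _ vt]].
  rewrite add0r -(subrK v t) linearDl /= vs// addr0 mulrC.
  apply: (le_trans (cauchy_schwarz ipH _ _)).
  by rewrite ler_wpM2r ?rnorm_ge0// rdistC.
have t1 : rnorm t <= 1.
  apply: (ler_epsM ler01) => e /close[v [_ v1 _ vt]].
  by rewrite mul1r -(subrK v t) (le_trans (rnormD _ _))// addrC rdistC lerD.
have Tt : sigma <= rnorm (T t).
  apply: (@ler_epsM _ (M + 1)); first by rewrite addr_ge0.
  move=> e /close[v [_ _ Tv vt]]; have : rnorm (T v) <= rnorm (T t) + M * e.
    rewrite -{1}(subrK t v) linD// (le_trans (rnormD _ _))// addrC lerD2l.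
    by rewrite (le_trans (TM _))// ler_wpM2l.
  by move: Tv; rewrite mulrDl mul1r; lra.
have t1' : rnorm t = 1.
  apply/eqP; rewrite eq_le t1 /= -(ler_pM2l sp) mulr1.
  exact: le_trans (smax _ ts).
have TtE : rnorm (T t) = sigma.
  by apply/eqP; rewrite eq_le Tt andbT (le_trans (smax _ ts))// t1' mulr1.
exists t; split => //; last by rewrite TtE.
(* Since [t] attains [sigma], the defect bound is zero and [t] is an exact eigenvector. *)
apply/eqP; rewrite -subr_eq0 -rnorm_eq0 -sqrf_eq0 eq_le sqr_ge0 andbT TtE.
have := maximizer_eigen_defect s0 eig smax ts t1.
by rewrite TtE subrr mulr0.
Qed.

End Greedy.

(** * Singular values *)

Lemma mem_mkseq (T : eqType) (f : nat -> T) n x :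
  x \in mkseq f n -> exists2 i, (i < n)%N & x = f i.
Proof. by move=> /mapP[k]; rewrite mem_iota => kn ->; exists k. Qed.

Section Dimension.
Variables (R : realType) (H : completeNormedModType R[i]).

Lemma has_dim_le (V : set H) d d' : has_dim V d -> has_dim V d' -> (d <= d')%N.
Proof.
move=> [e [efree eV]] [f [_ fV]].
have eP i : exists c : 'I_d' -> R[i], e i = \sum_(j < d') c j *: f j.
  have : V (e i).
    rewrite eV; exists (fun k => (k == i)%:R).
    rewrite (bigD1 i)//= eqxx scale1r big1 ?addr0// => k /negPf ->.
    by rewrite scale0r.
  by rewrite fV.
have [c cP] := choice eP; pose M := \matrix_(i < d, j < d') c i j.
suff /eqP <- : row_free M by exact: rank_leq_col.
apply: inj_row_free => v vM; apply/rowP => i; rewrite mxE; apply: efree => {i}.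
under eq_bigr do rewrite cP scaler_sumr.
rewrite exchange_big /= big1// => j _.
under eq_bigr do rewrite scalerA.
rewrite -scaler_suml; have := congr1 (fun w : 'rV_d' => w 0 j) vM.
rewrite !mxE; under eq_bigr do rewrite mxE.
by move=> ->; rewrite scale0r.
Qed.

Lemma has_dim_uniq (V : set H) d d' : has_dim V d -> has_dim V d' -> d = d'.
Proof. by move=> h h'; apply/eqP; rewrite eqn_leq !(@has_dim_le V). Qed.

End Dimension.

(** If [x] were outside [B], listing [B] and then [x] would send [d.+1] indices injectively into [d]
    places. *)
Lemma card_II_proper (A B : set nat) d x :
  (A #= `I_d)%card -> (B #= `I_d)%card -> B `<=` A -> A x -> B x.
Proof.
move=> Ad; rewrite card_eq_sym => Bd BA Ax; apply: contrapT => nBx.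
have [g [gA ginj _]] := card_set_bijP Ad; have [f [fB finj _]] := card_set_bijP Bd.
pose h k := if (k < d)%N then g (f k) else g x.
suff : (d.+1 <= d)%N by rewrite ltnn.
have fBk k : (k < d)%N -> B (f k) by move=> kd; exact: fB.
apply: (@pigeonhole _ _ h).
  move=> i j; rewrite !inE /= !ltnS /h => id jd.
  have gN k : (k < d)%N -> g (f k) <> g x.
    move=> kd /ginj; rewrite !inE => fx; apply: nBx; rewrite -fx//; first exact: fBk.
    by apply: BA; exact: fBk.
  case: ltnP => di; case: ltnP => dj.
  - move=> /ginj; rewrite !inE => /(_ (BA _ (fBk _ di)) (BA _ (fBk _ dj))) /finj.
    by rewrite !inE; apply.
  - by move=> /gN; case/(_ di).
  - by move=> /esym/gN; case/(_ dj).
  - by move=> _; apply/eqP; rewrite eqn_leq (leq_trans id dj) (leq_trans jd di).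
move=> _ [k _ <-]; rewrite /h; case: ltnP => kd; apply: gA => //.
by apply: BA; exact: fBk.
Qed.

(** At a first disagreement, say with [s' n < s n], monotonicity puts every index where [s'] equals
    [s n] before [n], where the sequences agree; the same set for [s] contains [n] as well, against
    equal cardinality. The value in question is positive, so multiplicities of zero are never
    consulted. *)
Lemma noninc_eq_of_multiplicity (R : realType) (s s' : nat -> R) :
  (forall n, 0 <= s n) -> (forall n, 0 <= s' n) ->
  (forall m n, (m <= n)%N -> s n <= s m) ->
  (forall m n, (m <= n)%N -> s' n <= s' m) ->
  (forall lam, 0 < lam -> exists d, ([set n | s n = lam] #= `I_d)%card /\
                                  ([set n | s' n = lam] #= `I_d)%card) ->
  forall n, s n = s' n.
Proof.
have half (t t' : nat -> R) n :
    (forall n, 0 <= t' n) -> (forall m n, (m <= n)%N -> t' n <= t' m) ->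
    (forall lam, 0 < lam -> exists d, ([set n | t n = lam] #= `I_d)%card /\
                                  ([set n | t' n = lam] #= `I_d)%card) ->
    (forall k, (k < n)%N -> t k = t' k) -> t n <= t' n.
  move=> t'0 t'd td tk; rewrite leNgt; apply/negP => ltn.
  have [|d [Ad Bd]] := td (t n); first by apply: le_lt_trans ltn.
  suff : t' n = t n by move=> e; rewrite e ltxx in ltn.
  apply: (card_II_proper Ad Bd) => // k /=.
  have [kn|nk] := ltnP k n; first by rewrite (tk k).
  by move=> e; have := le_lt_trans (t'd _ _ nk) ltn; rewrite e ltxx.
move=> s0 s'0 sd s'd ss'; elim/ltn_ind => n IH.
apply/eqP; rewrite eq_le; apply/andP; split; apply: half => //.
- by move=> lam /ss'[d [? ?]]; exists d.
- by move=> k kn; rewrite IH.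
Qed.

Section SingularValues.
Variables (R : realType) (H : completeNormedModType R[i]).
Variable ip : {dot H for (@Num.conj R[i])}.
Hypothesis ipH : hilbert_form ip.

(** [schatten] speaks of some [s]; uniqueness allows replacing it by the explicit values along a
    singular basis. *)
Lemma singular_values_uniq (T : H -> H) s s' :
  is_singular_values ip T s -> is_singular_values ip T s' -> s = s'.
Proof.
move=> [s0 sd [T1 adj1 h1]] [s'0 s'd [T2 adj2 h2]].
have T12 : T1 = T2.
  apply/funext => y; apply: (ip_inj ipH) => z.
  by rewrite (is_adjoint_sym adj1) (is_adjoint_sym adj2).
apply/funext; apply: noninc_eq_of_multiplicity => // lam lam0.
have [[d [sE dE]] [d' [s'E d'E]]] := (h1 _ lam0, h2 _ lam0).
by exists d; rewrite T12 in dE; split => //; rewrite (has_dim_uniq dE d'E).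
Qed.

Variables T T' : H -> H.
Hypothesis adj : is_adjoint ip T T'.

(** Right singular vectors, listed greedily. The sequence need not be complete in [H] and may miss
    part of the kernel of [T], but once the values tend to 0, [T] kills everything orthogonal to
    it. *)
Definition svd_basis (e : nat -> H) :=
  [/\ orthoseq ip e,
      forall n, T' (T (e n)) = (rnorm (T (e n)) ^+ 2)%:C *: e n &
      forall n u, perp ip (mkseq e n) u -> rnorm (T u) <= rnorm (T (e n)) * rnorm u].

Lemma exists_svd_basis : infinite_dimensional H -> compact_operator T ->
  exists e, svd_basis e.
Proof.
move=> infH cT.
pose P (s : seq H) t := [/\ rnorm t = 1, perp ip s t,
    T' (T t) = (rnorm (T t) ^+ 2)%:C *: t &
    forall u, perp ip s u -> rnorm (T u) <= rnorm (T t) * rnorm u].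
have [f n fP|e eP] := @history_choice H P.
  apply: exists_maximizer => // x /mem_mkseq[k kn ->].
  by exists (rnorm (T (f k)) ^+ 2)%:C; have [] := fP k kn.
exists e; split=> [|n|n u].
- by apply: (orthoseq_of_perp ipH) => n; have [] := eP n.
- by have [] := eP n.
- by have [_ _ _] := eP n; apply.
Qed.

Variable e : nat -> H.
Hypothesis svd : svd_basis e.
Let sigma n := rnorm (T (e n)).

Let oe : orthoseq ip e. Proof. by have [] := svd. Qed.

Lemma perp_mkseq n u : (forall i, (i < n)%N -> ip u (e i) = 0) -> perp ip (mkseq e n) u.
Proof. by move=> h x /mem_mkseq[k /h uk ->]. Qed.

Lemma svd_noninc m n : (m <= n)%N -> sigma n <= sigma m.
Proof.
move=> mn; have [_ _ h] := svd.
rewrite (le_trans (h m (e n) _)) ?(orthoseq_rnorm ipH _ oe) ?mulr1//.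
apply: perp_mkseq => i im; rewrite oe gtn_eqF//.
exact: leq_trans mn.
Qed.

Lemma svd_orth i j : i != j -> ip (T (e i)) (T (e j)) = 0.
Proof.
have [_ h _] := svd.
by move=> /negPf ij; rewrite -(adjoint_ip' adj) h ipZr oe ij mulr0.
Qed.

(** The vectors [T (e n)] are orthogonal; with norms at least [eps] they would stay [eps] apart and
    could not cluster. *)
Lemma svd_vanish : compact_operator T -> forall eps, 0 < eps -> exists N, sigma N < eps.
Proof.
move=> cT eps eps0; apply: contrapT => /forallNP h.
have hge n : eps <= sigma n by rewrite leNgt; apply/negP.
have [|l lP] := precompact_cluster (z := T \o e) cT.2.
  by move=> n; exists (e n) => //=; rewrite rnormE lecR (orthoseq_rnorm ipH _ oe).
have e2 : 0 < eps / 2 by rewrite divr_gt0.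
have [m _ ml] := lP _ 0%N e2; have [n mn nl] := lP _ m.+1 e2.
have close : rnorm (T (e m) - T (e n)) < eps.
  rewrite (le_lt_trans (rnorm_tri _ l _))// (splitr eps) ltrD//.
  by rewrite rdistC.
have far : eps ^+ 2 <= rnorm (T (e m) - T (e n)) ^+ 2.
  rewrite (pythagoras ipH) ?rnormN; last by rewrite linearNr /= svd_orth ?oppr0// ltn_eqF.
  rewrite -[leLHS]addr0 lerD ?sqr_ge0//.
  by rewrite ler_pXn2r ?nnegrE ?rnorm_ge0 ?(ltW eps0)//; exact: hge.
by move: far; rewrite ler_pXn2r ?nnegrE ?rnorm_ge0 ?(ltW eps0)// leNgt close.
Qed.

Hypothesis linT : linear T.
Hypothesis vanish : forall eps, 0 < eps -> exists N, sigma N < eps.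

Let linT' : linear T' := adjoint_linear ipH adj.

Lemma svd_ker u : (forall n, ip u (e n) = 0) -> T u = 0.
Proof.
move=> ue; apply/eqP; rewrite -rnorm_eq0 eq_le rnorm_ge0 andbT.
apply: (ler_epsM (rnorm_ge0 u)) => eps /vanish[N sN]; rewrite add0r mulrC.
have [_ _ h] := svd; apply: le_trans (h N u _) _; first exact: perp_mkseq.
by rewrite ler_wpM2r ?rnorm_ge0// ltW.
Qed.

(** The eigenspace for [lam ^+ 2] is spanned by the [e n] with [sigma n = lam]: subtracting from an
    eigenvector its projection on them leaves an eigenvector orthogonal to all [e n], the others
    having a different eigenvalue. So [T] kills it, and as [lam] is positive it is zero. *)
Lemma svd_singular_values : is_singular_values ip T sigma.
Proof.
have [_ eig _] := svd.
split; [by move=> n; exact: rnorm_ge0|exact: svd_noninc|exists T' => // lam lam0].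
have [d dE] : finite_set [set n | sigma n = lam].
  have [N sN] := vanish lam0; apply: (sub_finite_set _ (finite_II N)) => n /= sn.
  by rewrite ltnNge; apply/negP => /svd_noninc; rewrite sn leNgt sN.
exists d; split => //.
move: dE; rewrite card_eq_sym => /card_set_bijP[f [fE finj fsurj]].
have fs (i : nat) : (i < d)%N -> sigma (f i) = lam by move=> id; exact: fE.
have og : ortho ip (e \o f) d.
  move=> i j id jd; rewrite /= oe; congr (nat_of_bool _)%:R.
  apply/eqP/eqP => [/finj|->//]; rewrite !inE; exact.
have geig i : (i < d)%N -> T' (T (e (f i))) = (lam ^+ 2)%:C *: e (f i).
  by move=> id; rewrite eig; congr ((_ ^+ 2)%:C *: _); exact: fs.
exists (fun i => e (f i)); split.
  move=> c c0 i; pose c' k := if insub k is Some j then c j else 0.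
  have c'E (j : 'I_d) : c' j = c j by rewrite /c' valK.
  rewrite -c'E; apply: (ortho_free og) => //.
  by rewrite -[RHS]c0; apply: eq_bigr => j _; rewrite c'E.
apply/seteqP; split => [u|_ [c ->]] /=; rewrite /op_eigenspace /=; last first.
  rewrite (lin_sum linT) (lin_sum linT') scaler_sumr; apply: eq_bigr => i _.
  by rewrite (linZ linT) (linZ linT') geig// !scalerA mulrC.
move=> Tu; exists (fun i => ip u (e (f i))).
pose v := u - proj ip (e \o f) d u.
suff v0 : v = 0 by apply/eqP; rewrite -subr_eq0; apply/eqP.
have Tv : T' (T v) = (lam ^+ 2)%:C *: v.
  rewrite /v (linB linT) (linB linT') Tu scalerBr; congr (_ - _).
  rewrite /proj (lin_sum linT) (lin_sum linT') scaler_sumr; apply: eq_bigr => i _.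
  by rewrite (linZ linT) (linZ linT') geig// !scalerA mulrC.
have l20 : (lam ^+ 2)%:C != 0 :> R[i] by rewrite fmorph_eq0 expf_eq0 /= gt_eqF.
suff Tv0 : T v = 0.
  by apply/eqP; move: Tv; rewrite Tv0 lin0// => /esym/eqP; rewrite scaler_eq0 (negPf l20).
apply: svd_ker => n; have [sn|sn] := eqVneq (sigma n) lam.
  have [i /= id <-] := fsurj n sn.
  exact: (proj_ortho u og id).
have : ip (T' (T v)) (e n) = ip v (T' (T (e n))).
  by rewrite (adjoint_ip adj) (adjoint_ip' adj).
rewrite Tv eig ipZl ipZr [_^*]conjc_real => /eqP.
rewrite -subr_eq0 -mulrBl mulf_eq0 => /orP[|/eqP//].
rewrite -rmorphB /= fmorph_eq0 subr_eq0 eqrXn2 ?rnorm_ge0 ?(ltW lam0)// => /eqP e'.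
by move: sn; rewrite e' eqxx.
Qed.

End SingularValues.

(** * p-summable sequences *)

Lemma sum_ord_split (V : nmodType) (g : nat -> V) N M : (N <= M)%N ->
  \sum_(k < M) g k = \sum_(k < N) g k + \sum_(N <= k < M) g k.
Proof. by move=> NM; rewrite -!(big_mkord xpredT g) (big_cat_nat (n := N) (p := M)). Qed.

Section PSummable.
Variable R : realType.
Implicit Types (p : R) (s t c : nat -> R).

Definition psummable p t := exists B : R, forall N, \sum_(n < N) t n `^ p <= B.

Lemma lp_normP p s : 0 < p -> (lp_norm p s < +oo)%E <-> psummable p s.
Proof.
move=> p0; have pV0 : p^-1 != 0 by rewrite invr_eq0 gt_eqF.
have s0 n : (0 <= (s n `^ p)%:E)%E by rewrite lee_fin powR_ge0.
rewrite /lp_norm; split=> [/(lty_poweRy pV0) fin|[B sB]].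
  exists (fine (\sum_(0 <= n <oo) (s n `^ p)%:E)%E) => N.
  rewrite -lee_fin fineK; last first.
    by rewrite ge0_fin_numE// nneseries_ge0.
  by rewrite -sumEFin -(big_mkord xpredT (fun n => (s n `^ p)%:E)) nneseries_lim_ge.
apply: poweR_lty; apply: (@le_lt_trans _ _ B%:E); last exact: ltry.
apply: lime_le; first exact: is_cvg_nneseries.
by apply: nearW => N; rewrite big_mkord sumEFin lee_fin.
Qed.

(** The convex power lies above its tangent at [t]; this is Young's inequality for [a] and
    [t ^ (p - 1)]. The case [p = 1] is separate because the conjugate exponent is infinite. *)
Lemma powR_tangent (p a t : R) : 1 <= p -> 0 <= a -> 0 <= t ->
  t `^ p + p * t `^ (p - 1) * (a - t) <= a `^ p.
Proof.
rewrite le_eqVlt => /predU1P[<-|p1] a0 t0.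
  by rewrite subrr powRr0 mulr1 mul1r !powRr1// addrC subrK.
have p0 : 0 < p by rewrite (lt_trans ltr01).
have p10 : 0 < p - 1 by rewrite subr_gt0.
have pN0 : p != 0 by rewrite gt_eqF.
have p1N0 : p - 1 != 0 by rewrite gt_eqF.
have conj : p^-1 + (p / (p - 1))^-1 = 1 by rewrite invf_div; field.
have := conjugate_powR a0 (powR_ge0 t (p - 1)) p0 (divr_gt0 p0 p10) conj.
rewrite -powRrM (mulrC (p - 1)) divfK// -(ler_pM2l p0) => h.
have tp : t * t `^ (p - 1) = t `^ p by rewrite mulr_powRB1.
have e1 : p * (a `^ p / p + t `^ p / (p / (p - 1))) = a `^ p + (p - 1) * t `^ p.
  by field; apply/andP.
rewrite e1 in h; rewrite -tp; rewrite -tp in h.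
by move: h; lra.
Qed.

(** Jensen's inequality for weights of total mass at most 1: sum the tangent inequalities at [t];
    the missing mass leaves a surplus [(p - 1) (1 - M) t^p], which is nonnegative. *)
Lemma powR_jensen p n (m x : nat -> R) : 1 <= p ->
  (forall k, 0 <= m k) -> (forall k, 0 <= x k) -> \sum_(k < n) m k <= 1 ->
  (\sum_(k < n) m k * x k) `^ p <= \sum_(k < n) m k * x k `^ p.
Proof.
move=> p1 m0 x0 m1; set t := \sum_(k < n) m k * x k.
have p0 : 0 < p by rewrite (lt_le_trans ltr01).
have t0 : 0 <= t by apply: sumr_ge0 => k _; exact: mulr_ge0.
apply: (@le_trans _ _ (\sum_(k < n) m k * (t `^ p + p * t `^ (p - 1) * (x k - t)))); last first.
  by apply: ler_sum => k _; rewrite ler_wpM2l// powR_tangent.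
have -> : \sum_(k < n) m k * (t `^ p + p * t `^ (p - 1) * (x k - t)) =
    (\sum_(k < n) m k) * t `^ p + p * t `^ (p - 1) * (t - (\sum_(k < n) m k) * t).
  rewrite {4}/t !mulr_suml -sumrB mulr_sumr -big_split /=; apply: eq_bigr => k _.
  by ring.
have := mulr_powRB1 t0 p0; set q := t `^ (p - 1) => tq.
have tp0 := powR_ge0 t p; move: tq tp0 m1 p1.
set M := \sum_(k < n) m k; set z := t `^ p => tq z0 M1 p1.
have -> : p * q * (t - M * t) = p * z * (1 - M) by rewrite -tq; ring.
suff : 0 <= z * ((p - 1) * (1 - M)) by lra.
by rewrite !mulr_ge0// subr_ge0.
Qed.

Lemma powRD_le (p a b : R) : 0 <= p -> 0 <= a -> 0 <= b ->
  (a + b) `^ p <= 2 `^ p * (a `^ p + b `^ p).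
Proof.
move=> p0 a0 b0; wlog ab : a b a0 b0 / a <= b.
  move=> h; have [ab|/ltW ba] := leP a b; first exact: h.
  by rewrite (addrC a) (addrC (a `^ p)); exact: h.
apply: (@le_trans _ _ ((2 * b) `^ p)).
  by apply: ge0_ler_powR => //; rewrite ?nnegrE ?addr_ge0 ?mulr_ge0// mulr_natl mulr2n lerD2r.
by rewrite powRM// ler_wpM2l ?powR_ge0// lerDr powR_ge0.
Qed.

Lemma psummable_le p s t : 0 <= p -> (forall n, 0 <= s n <= t n) ->
  psummable p t -> psummable p s.
Proof.
move=> p0 st [B tB]; exists B => N; apply: le_trans (tB N).
apply: ler_sum => n _; have /andP[s0 st'] := st n.
by apply: ge0_ler_powR => //; rewrite nnegrE// (le_trans s0).
Qed.

Lemma psummableD p s t : 0 <= p -> (forall n, 0 <= s n) -> (forall n, 0 <= t n) ->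
  psummable p s -> psummable p t -> psummable p (fun n => s n + t n).
Proof.
move=> p0 s0 t0 [B sB] [C tC]; exists (2 `^ p * (B + C)) => N.
apply: (@le_trans _ _ (\sum_(n < N) 2 `^ p * (s n `^ p + t n `^ p))).
  by apply: ler_sum => n _; exact: powRD_le.
rewrite -mulr_sumr big_split /= ler_wpM2l ?powR_ge0//.
exact: lerD (sB N) (tC N).
Qed.

Lemma sum_half_le2 N : \sum_(n < N) 2^-1 ^+ n <= 2 :> R.
Proof.
suff -> : \sum_(n < N) 2^-1 ^+ n = 2 - 2 * 2^-1 ^+ N :> R.
  by rewrite gerBl mulr_ge0// exprn_ge0// invr_ge0.
elim: N => [|N IH]; first by rewrite big_ord0 expr0 mulr1 subrr.
by rewrite big_ord_recr /= IH exprS; field.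
Qed.

Lemma psummable_geometric p (K : R) : 1 <= p -> 0 <= K ->
  psummable p (fun n => K * 2^-1 ^+ n).
Proof.
move=> p1 K0; exists (K `^ p * 2) => N.
have h0 n : 0 <= 2^-1 ^+ n :> R by rewrite exprn_ge0// invr_ge0.
apply: (@le_trans _ _ (\sum_(n < N) K `^ p * 2^-1 ^+ n)).
  apply: ler_sum => n _; rewrite powRM// ler_wpM2l ?powR_ge0//.
  apply: ge1r_powR => //; rewrite exprn_gt0 ?invr_gt0//=.
  by rewrite exprn_ile1 ?invr_ge0// invf_le1// ler1n.
rewrite -mulr_sumr ler_wpM2l ?powR_ge0//.
exact: sum_half_le2.
Qed.

Lemma psummable_eventually0 p t K : 0 < p -> (forall n, (K <= n)%N -> t n = 0) ->
  psummable p t.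
Proof.
move=> p0 t0; exists (\sum_(n < K) t n `^ p) => N.
have [NK|/ltnW KN] := leqP N K.
  rewrite (sum_ord_split (fun n => t n `^ p) NK) lerDl sumr_ge0// => i _.
  exact: powR_ge0.
rewrite (sum_ord_split (fun n => t n `^ p) KN) gerDl big_nat_cond big1//.
by move=> i /andP[/andP[Ki _] _]; rewrite t0// powR0 ?gt_eqF.
Qed.

(* Abel-Dini: if [S n = 1 + \sum_(k <= n) t k ^ p] is unbounded, so are the
   partial sums of [t n ^ p / S n]. *)
Lemma psummable_of_weights p t : 1 <= p -> (forall n, 0 <= t n) ->
  (forall c, (forall n, 0 <= c n) -> (forall m n, (m <= n)%N -> c n <= c m) ->
     (forall eps, 0 < eps -> exists N, c N < eps) ->
     psummable p (fun n => c n * t n)) ->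
  psummable p t.
Proof.
move=> p1 t0 h; have p0 : 0 < p by rewrite (lt_le_trans ltr01).
apply: contrapT => nt; pose S n := 1 + \sum_(k < n) t k `^ p.
have Sinc m n : (m <= n)%N -> S m <= S n.
  move=> mn; rewrite lerD2l (sum_ord_split (fun k => t k `^ p) mn) lerDl sumr_ge0//.
  by move=> i _; exact: powR_ge0.
have S1 n : 1 <= S n by rewrite lerDl sumr_ge0// => i _; exact: powR_ge0.
have S0 n : 0 < S n by exact: lt_le_trans (S1 n).
have Sub B : exists n, B < S n.
  apply: contrapT => /forallNP hB; apply: nt; exists B => N.
  by rewrite (le_trans (_ : _ <= S N)) ?lerDr// leNgt; apply/negP.
(* The exponent makes the p-th power of [c n * t n] the Abel-Dini term [t n ^ p / S n.+1]. *)
pose c n := (S n.+1)^-1 `^ p^-1.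
have cp n : c n `^ p = (S n.+1)^-1.
  by rewrite -powRrM mulVf ?gt_eqF// powRr1// invr_ge0 ltW.
have [||eps eps0|B sB] := h c.
- by move=> n; exact: powR_ge0.
- move=> m n mn; apply: ge0_ler_powR; rewrite ?nnegrE ?invr_ge0 ?(ltW (S0 _)) ?(ltW p0)//.
  by rewrite lef_pV2 ?posrE//; exact: Sinc.
- have [n Sn] := Sub (eps^-1 `^ p); exists n.
  suff : c n `^ p < eps `^ p.
    by rewrite ltNge [in X in _ -> X]ltNge => /negP q; apply/negP => ec; apply: q;
       apply: ge0_ler_powR ec; rewrite ?nnegrE ?powR_ge0 ?(ltW p0)// ltW.
  have ep := powR_gt0 p eps0.
  rewrite cp -[ltRHS]invrK ltf_pV2 ?posrE ?invr_gt0//.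
  apply: lt_le_trans (Sinc _ _ (leqnSn n)); apply: le_lt_trans Sn.
  by rewrite -powRN -(powR_inv1 (ltW eps0)) -powRrM mulN1r.
pose P N := \sum_(n < N) t n `^ p / S n.+1.
have PB N : P N <= B.
  apply: le_trans (sB N); apply: ler_sum => n _.
  by rewrite powRM ?powR_ge0// cp mulrC.
have supP : has_sup (range P) by split; [exists (P 0%N), 0%N|exists B => _ [N _ <-]].
(* [P N] is within 1/2 of the supremum, yet once [S M] exceeds [2 * S N] the terms from [N] to [M]
   add more than 1/2. *)
have [_ [N _ <-] PN] := sup_adherent (divr_gt0 ltr01 (@ltr0Sn R 1)) supP.
have [M SM] := Sub (2 * S N).
have NM : (N <= M)%N.
  rewrite leqNgt; apply/negP => /ltnW/Sinc SMN.
  by have := S0 N; have := S0 M; lra.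
have PM : P M <= sup (range P) by apply: ub_le_sup; [exact: supP.2|exists M].
have : (S M - S N) / S M <= P M - P N.
  have -> : S M - S N = \sum_(N <= k < M) t k `^ p.
    by rewrite /S (sum_ord_split (fun k => t k `^ p) NM); ring.
  have -> : P M - P N = \sum_(N <= k < M) t k `^ p / S k.+1.
    by rewrite /P (sum_ord_split (fun k => t k `^ p / S k.+1) NM); ring.
  rewrite mulr_suml; apply: ler_sum_nat => i /andP[_ iM].
  by rewrite ler_wpM2l ?powR_ge0// lef_pV2 ?posrE//; exact: Sinc.
rewrite mulrBl divff ?gt_eqF// => h1.
have : S N / S M < 1 / 2 by rewrite ltr_pdivrMr// mulrC mulrA mulr1 ltr_pdivlMr// mulrC.
by move: h1 PN PM; lra.
Qed.

End PSummable.

(** * Diagonal coefficients of Schatten class operators *)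

Section SchattenDiagonal.
Variables (R : realType) (H : completeNormedModType R[i]).
Variable ip : {dot H for (@Num.conj R[i])}.
Hypothesis ipH : hilbert_form ip.
Variable p : R.
Hypothesis p1 : 1 <= p.

Let p0 : 0 < p. Proof. exact: lt_le_trans p1. Qed.

Lemma ortho_normalized_image (T T' : H -> H) (e : nat -> H) K :
  is_adjoint ip T T' -> svd_basis ip T T' e ->
  (forall k, (k < K)%N -> T (e k) != 0) ->
  ortho ip (fun k => (rnorm (T (e k)))^-1%:C *: T (e k)) K.
Proof.
move=> adj svd Te i j iK jK; have [->|ij] := eqVneq i j.
  by rewrite (ipE ipH) rnorm_normalize ?expr1n// Te.
by rewrite ipZl ipZr (svd_orth adj svd ij) !mulr0.
Qed.

(** The bound does not depend on [M]. Truncating [T] at level [d = 1 / (M + 1)] costs at most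
    [M * d ^ p <= 1], whence [B + 1]; the factor [2 ^ p] separates the truncated part from the
    error. *)
Lemma svd_diag_bound (T T' : H -> H) (e u v : nat -> H) (B : R) M :
  linear T -> is_adjoint ip T T' -> svd_basis ip T T' e ->
  (forall eps, 0 < eps -> exists N, rnorm (T (e N)) < eps) ->
  orthoseq ip u -> orthoseq ip v ->
  (forall N, \sum_(n < N) rnorm (T (e n)) `^ p <= B) ->
  \sum_(n < M) rnorm (ip (T (u n)) (v n)) `^ p <= 2 `^ p * (B + 1).
Proof.
move=> linT adj svd vanish ou ov sB.
have oe : orthoseq ip e by have [] := svd.
pose d : R := (M.+1%:R)^-1; have d0 : 0 < d by rewrite invr_gt0.
(* Minimality of [K] keeps the earlier singular values at least [d], hence invertible; on the
   complement of the first [K] vectors [T] has norm below [d]. *)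
have [K Kd Kmin] := find_ex_minn (vanish _ d0).
pose sg k := rnorm (T (e k)); pose f k := (sg k)^-1%:C *: T (e k).
have sg0 k : (k < K)%N -> 0 < sg k.
  move=> kK; apply: lt_le_trans d0 _; rewrite leNgt; apply/negP => /Kmin.
  by rewrite leqNgt kK.
have of_ : ortho ip f K.
  apply: (ortho_normalized_image adj svd) => k /sg0 sk.
  by rewrite -rnorm_eq0 gt_eqF.
have TeE k : (k < K)%N -> T (e k) = (sg k)%:C *: f k.
  by move=> kK; rewrite scalerA -rmorphM /= mulfV ?scale1r// gt_eqF// sg0.
(* [<T u_n, v_n>] is about [\sum_k sg k <u_n, e_k> <f_k, v_n>]; by AM-GM the
   products are dominated by the doubly substochastic matrix [m]. *)
pose m n k := (rnorm (ip (u n) (e k)) ^+ 2 +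
               (if (k < K)%N then rnorm (ip (v n) (f k)) ^+ 2 else 0)) / 2.
have m0 n k : 0 <= m n k.
  by rewrite divr_ge0// addr_ge0 ?sqr_ge0//; case: ifP => // _; exact: sqr_ge0.
have mrow n : \sum_(k < K) m n k <= 1.
  rewrite -mulr_suml ler_pdivrMr// mul1r big_split /=.
  have h1 := bessel ipH (u n) (orthoseqW (n := K) oe).
  have h2 := bessel ipH (v n) of_.
  rewrite (orthoseq_rnorm ipH _ ou) in h1; rewrite (orthoseq_rnorm ipH _ ov) in h2.
  have -> : \sum_(k < K) (if (k < K)%N then rnorm (ip (v n) (f k)) ^+ 2 else 0) =
    \sum_(k < K) rnorm (ip (v n) (f k)) ^+ 2.
    by apply: eq_bigr => k _; rewrite ltn_ord.
  by move: h1 h2; rewrite expr1n; lra.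
have mcol k : (k < K)%N -> \sum_(n < M) m n k <= 1.
  move=> kK; rewrite -mulr_suml ler_pdivrMr// mul1r big_split /= kK.
  have h1 := bessel ipH (e k) (orthoseqW (n := M) ou).
  have h2 := bessel ipH (f k) (orthoseqW (n := M) ov).
  rewrite (orthoseq_rnorm ipH _ oe) in h1; rewrite (ortho_rnorm ipH of_ kK) in h2.
  have -> : \sum_(n < M) rnorm (ip (u n) (e k)) ^+ 2 =
    \sum_(n < M) rnorm (ip (e k) (u n)) ^+ 2.
    by apply: eq_bigr => n _; rewrite rnorm_ipC.
  have -> : \sum_(n < M) rnorm (ip (v n) (f k)) ^+ 2 =
    \sum_(n < M) rnorm (ip (f k) (v n)) ^+ 2.
    by apply: eq_bigr => n _; rewrite rnorm_ipC.
  by move: h1 h2; rewrite expr1n; lra.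
pose b n := \sum_(k < K) m n k * sg k.
have b0 n : 0 <= b n by apply: sumr_ge0 => k _; rewrite mulr_ge0 ?rnorm_ge0.
have tb n : rnorm (ip (T (u n)) (v n)) <= b n + d.
  rewrite -[u n](subrK (proj ip e K (u n))) (linD linT) linearDl /=.
  rewrite (le_trans (rnormD _ _))// addrC lerD//; last first.
    rewrite (le_trans (cauchy_schwarz ipH _ _))// (orthoseq_rnorm ipH _ ov) mulr1.
    have [_ _ h] := svd; apply: le_trans (h K _ _) _.
      by apply: perp_mkseq => i iK; apply: proj_ortho => //; exact: orthoseqW.
    rewrite (le_trans _ (ltW Kd))// ler_piMr ?rnorm_ge0//.
    rewrite (le_trans (rnorm_sub_proj_le ipH _ (orthoseqW oe)))//.
    by rewrite (orthoseq_rnorm ipH _ ou).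
  rewrite /proj (lin_sum linT) linear_sumlz (le_trans (rnorm_sum _ _ _))//.
  apply: ler_sum => k _; rewrite (linZ linT) /= ipZl rnormM TeE// ipZl rnormM rnorm_real.
  rewrite (ger0_norm (rnorm_ge0 _)) -/(sg k) mulrCA mulrC ler_wpM2r ?rnorm_ge0//.
  rewrite /m ltn_ord (rnorm_ipC _ (f k)).
  set x := rnorm _; set y := rnorm _; have := sqr_ge0 (x - y).
  by rewrite sqrrB; lra.
apply: (@le_trans _ _ (\sum_(n < M) 2 `^ p * (b n `^ p + d `^ p))).
  apply: ler_sum => n _; apply: le_trans (powRD_le (ltW p0) (b0 n) (ltW d0)).
  by apply: ge0_ler_powR; rewrite ?nnegrE ?rnorm_ge0 ?(ltW p0)// addr_ge0// ltW.
rewrite -mulr_sumr ler_wpM2l ?powR_ge0// big_split /= lerD//; last first.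
  rewrite sumr_const card_ord -mulr_natl (@le_trans _ _ (M%:R * d))//.
    rewrite ler_wpM2l// ge1r_powR// d0/= invf_le1// ler1n//.
  by rewrite ler_pdivrMr// mul1r ler_nat.
(* Row sums at most 1 allow Jensen; after exchanging the sums, column sums at most 1 remove [m]. *)
apply: (@le_trans _ _ (\sum_(n < M) \sum_(k < K) m n k * sg k `^ p)).
  apply: ler_sum => n _; apply: powR_jensen => // k; exact: rnorm_ge0.
rewrite exchange_big /=; apply: le_trans (sB K); apply: ler_sum => k _.
by rewrite -mulr_suml ler_piMl ?powR_ge0// mcol.
Qed.

Lemma schatten_diag (T : H -> H) (u v : nat -> H) : infinite_dimensional H ->
  schatten ip p T -> orthoseq ip u -> orthoseq ip v ->
  psummable p (fun n => rnorm (ip (T (u n)) (v n))).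
Proof.
move=> infH [cT [s sT sp]] ou ov.
have [T' adj] : exists T', is_adjoint ip T T' by have [_ _ [T' adj _]] := sT; exists T'.
have [e svd] := exists_svd_basis ipH adj infH cT.
have vanish := svd_vanish ipH adj svd cT.
have sE := singular_values_uniq ipH sT (svd_singular_values ipH adj svd cT.1 vanish).
have [B sB] := (lp_normP s p0).1 sp; exists (2 `^ p * (B + 1)) => M.
apply: (svd_diag_bound _ cT.1 adj svd vanish ou ov) => N.
by have := sB N; rewrite sE.
Qed.

(* Otherwise there are unit vectors [e n] with [eps < rnorm (y (e n))], orthogonal
   to [e j] and to [y' (y (e j))] for [j < n]; then the [y (e n)] are orthogonal. *)
Lemma small_off_of_diag (y y' : H -> H) (eps : R) : linear y -> is_adjoint ip y y' ->
  (forall e f, orthoseq ip e -> orthoseq ip f ->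
     psummable p (fun n => rnorm (ip (y (e n)) (f n)))) ->
  0 < eps -> exists s, small_off ip y eps s.
Proof.
move=> liny adj hy eps0; apply: contrapT => /forallNP nsmall.
pose P (s : seq H) t :=
  [/\ rnorm t = 1, perp ip s t, perp ip (map (y' \o y) s) t & eps < rnorm (y t)].
have [f n _|e eP] := @history_choice H P.
  pose s := mkseq f n ++ map (y' \o y) (mkseq f n).
  have /existsNP[u /not_implyP[us /negP]] := nsmall s; rewrite -ltNge => yu.
  have u0 : u != 0.
    by apply: contraTneq yu => ->; rewrite (lin0 liny) !rnorm0 mulr0 ltxx.
  have nu : 0 < rnorm u by rewrite rnorm_gt0.
  exists ((rnorm u)^-1%:C *: u); split; first exact: rnorm_normalize.
  - by move=> x xs; rewrite ipZl us ?mulr0// mem_cat xs.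
  - by move=> x xs; rewrite ipZl us ?mulr0// mem_cat xs orbT.
  - by rewrite (linZ liny) rnorm_scale normfV (ger0_norm (ltW nu)) mulrC ltr_pdivlMr.
have oe : orthoseq ip e by apply: (orthoseq_of_perp ipH) => n; have [] := eP n.
have ye n : eps < rnorm (y (e n)) by have [] := eP n.
have yn0 n : y (e n) != 0 by rewrite -rnorm_gt0 (lt_trans eps0).
pose f n := (rnorm (y (e n)))^-1%:C *: y (e n).
have lt k l : (k < l)%N -> ip (y (e k)) (y (e l)) = 0.
  move=> kl; rewrite -(adjoint_ip adj); apply: ip_eq0C.
  have [_ _ h _] := eP l; apply: h; apply/mapP; exists (e k) => //.
  by apply/mapP; exists k => //; rewrite mem_iota.
have orth i j : i != j -> ip (y (e i)) (y (e j)) = 0.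
  by rewrite neq_ltn => /orP[/lt//|/lt/ip_eq0C].
have of_ : orthoseq ip f.
  move=> i j; have [->|ij] := eqVneq i j.
    by rewrite (ipE ipH) rnorm_normalize ?expr1n.
  by rewrite ipZl ipZr orth// !mulr0.
have [B sB] := hy e f oe of_.
(* Against the normalized images [f], each diagonal coefficient is [rnorm (y (e n))], which exceeds
   [eps]. *)
have key (N : nat) : N%:R * eps `^ p <= B.
  apply: le_trans (sB N); rewrite mulr_natl -[N in _ *+ N]card_ord -sumr_const.
  apply: ler_sum => n _; apply: ge0_ler_powR; rewrite ?nnegrE ?rnorm_ge0 ?(ltW p0) ?(ltW eps0)//.
  rewrite /f ipZr rnormM rnorm_conj rnorm_real (rnorm_ip_self ipH) normfV.
  by rewrite (ger0_norm (rnorm_ge0 _)) expr2 mulKf ?rnorm_eq0// ltW.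
have e0 := powR_gt0 p eps0.
have := key (Num.truncn (B / eps `^ p)).+1; rewrite -ler_pdivlMr// leNgt => /negP; apply.
exact: truncnS_gt.
Qed.

Lemma schatten_of_diag (y y' : H -> H) : infinite_dimensional H ->
  linear y -> is_adjoint ip y y' ->
  (forall e f, orthoseq ip e -> orthoseq ip f ->
     psummable p (fun n => rnorm (ip (y (e n)) (f n)))) ->
  schatten ip p y.
Proof.
move=> infH liny adj hy.
have cy : compact_operator y.
  by apply: (compact_of_small_off ipH) => // eps; exact: small_off_of_diag adj hy.
split => //; have [e svd] := exists_svd_basis ipH adj infH cy.
have vanish := svd_vanish ipH adj svd cy.
exists (fun n => rnorm (y (e n))); first exact: svd_singular_values.
apply/(lp_normP _ p0).
(* The left singular vectors exist only where [y (e n)] is nonzero; if it vanishes once, it vanishes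
   from then on and summability is trivial. *)
have [[K yK]|/forallNP yn0] := pselect (exists K, y (e K) = 0).
  apply: (@psummable_eventually0 _ _ _ K p0) => n /(svd_noninc ipH svd).
  by rewrite yK rnorm0 => h; apply/eqP; rewrite eq_le h rnorm_ge0.
have y0 n : y (e n) != 0 by apply/eqP.
have oe : orthoseq ip e by have [] := svd.
have [|B sB] := hy e (fun k => (rnorm (y (e k)))^-1%:C *: y (e k)) oe.
  move=> i j; apply: (ortho_normalized_image (K := (maxn i j).+1) adj svd) => //.
    by rewrite ltnS leq_maxl.
  by rewrite ltnS leq_maxr.
exists B => N; apply: le_trans (sB N); rewrite le_eqVlt; apply/orP; left; apply/eqP.
apply: eq_bigr => n _; congr (_ `^ _).
rewrite ipZr rnormM rnorm_conj rnorm_real (rnorm_ip_self ipH) normfV.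
by rewrite (ger0_norm (rnorm_ge0 _)) expr2 mulKf ?rnorm_eq0.
Qed.

End SchattenDiagonal.

(** * Diagonal operators and nearly diagonal sequences *)

Lemma cauchy_seq_lim (R : realType) (H : completeNormedModType R[i]) (z : nat -> H) :
  (forall eps : R, 0 < eps -> exists N, forall n, (N <= n)%N -> rnorm (z N - z n) < eps) ->
  exists l, forall eps : R, 0 < eps -> exists N, forall n, (N <= n)%N -> rnorm (l - z n) < eps.
Proof.
move=> hz; have : cauchy (z @ \oo).
  apply: cauchy_exP => e /gt0C_real[eps eps0 ->].
  have [N hN] := hz _ eps0; exists (z N); rewrite ballRE.
  by exists N => // n /= /hN.
move=> /cauchy_cvg/cvg_ex[l zl]; exists l => eps eps0.
by have [N _ hN] := zl _ (nbhs_rnorm l eps0); exists N => n /hN.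
Qed.

Section DiagonalOperator.
Variables (R : realType) (H : completeNormedModType R[i]).
Variable ip : {dot H for (@Num.conj R[i])}.
Hypothesis ipH : hilbert_form ip.
Variables (c : nat -> R) (f v : nat -> H).
Hypotheses (c0 : forall n, 0 <= c n) (cdec : forall m n, (m <= n)%N -> c n <= c m).
Hypothesis cvanish : forall eps, 0 < eps -> exists N, c N < eps.
Hypotheses (of_ : orthoseq ip f) (ov : orthoseq ip v).

Let S N u := \sum_(k < N) ((c k)%:C * ip u (f k)) *: v k.

Let S_lin N d u w : S N (d *: u + w) = d *: S N u + S N w.
Proof.
rewrite /S scaler_sumr -big_split; apply: eq_bigr => k _ /=.
by rewrite linearDl /= ipZl scalerA -scalerDl; congr (_ *: _); ring.
Qed.

(** Orthonormality of [v] turns the tail into a sum of squares, monotonicity extracts [c N], and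
    Bessel for [f] bounds the rest. *)
Let S_dist N M u : (N <= M)%N -> rnorm (S N u - S M u) <= c N * rnorm u.
Proof.
move=> NM; pose d k := if (k < N)%N then 0 else (c k)%:C * ip u (f k).
have -> : S N u - S M u = - \sum_(k < M) d k *: v k.
  rewrite /S (sum_ord_split (fun k => ((c k)%:C * ip u (f k)) *: v k) NM).
  rewrite (sum_ord_split (fun k => d k *: v k) NM) opprD addrA subrr add0r.
  rewrite [X in _ = - (X + _)]big1 ?add0r; last first.
    by move=> k _; rewrite /d ltn_ord scale0r.
  congr (- _); apply: eq_big_nat => k /andP[Nk _].
  by rewrite /d ltnNge Nk.
rewrite rnormN -(@ler_pXn2r _ 2)// ?nnegrE ?mulr_ge0 ?rnorm_ge0//.
rewrite (rnorm_sum_ortho ipH d (orthoseqW ov)) exprMn.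
apply: (@le_trans _ _ (c N ^+ 2 * \sum_(k < M) rnorm (ip u (f k)) ^+ 2)); last first.
  by rewrite ler_wpM2l ?sqr_ge0//; apply: bessel => //; exact: orthoseqW.
rewrite mulr_sumr; apply: ler_sum => k _; rewrite /d; case: ltnP => kN.
  by rewrite rnorm0 expr0n mulr_ge0 ?sqr_ge0.
rewrite rnormM rnorm_real (ger0_norm (c0 _)) exprMn ler_wpM2r ?sqr_ge0//.
by rewrite ler_pXn2r ?nnegrE//; exact: cdec.
Qed.

Lemma exists_diag_operator : exists a : H -> H,
  [/\ compact_operator a,
      forall u N, rnorm (a u - \sum_(k < N) ((c k)%:C * ip u (f k)) *: v k) <=
                  c N * rnorm u &
      forall u n, ip (a u) (v n) = (c n)%:C * ip u (f n)].
Proof.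
have lim u : exists l, forall eps : R, 0 < eps ->
    exists N, forall n, (N <= n)%N -> rnorm (l - S n u) < eps.
  apply: cauchy_seq_lim => eps eps0.
  have u1 : 0 < rnorm u + 1 by rewrite ltr_wpDl// rnorm_ge0.
  have [N cN] := cvanish (divr_gt0 eps0 u1); exists N => n Nn.
  apply: (le_lt_trans (S_dist u Nn)); move: cN; rewrite ltr_pdivlMr//.
  by apply: le_lt_trans; rewrite ler_wpM2l// lerDl.
have [a aP] := choice lim; exists a.
have aS u N : rnorm (a u - S N u) <= c N * rnorm u.
  apply: (ler_epsM ler01) => eps /(aP u)[N' hN']; rewrite mul1r.
  have [NM N'M] := (leq_maxl N N', leq_maxr N N').
  rewrite (le_trans (rnorm_tri _ (S (maxn N N') u) _))// addrC lerD//.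
    by rewrite rdistC S_dist.
  by rewrite ltW// hN'.
(* Identities of the partial sums pass to [a], since every error is a constant times [c N]. *)
have eq_of_le (V : normedZmodType R[i]) (x y : V) (K : R) : 0 <= K ->
    (forall N, rnorm (x - y) <= K * c N) -> x = y.
  move=> K0 h; apply/eqP; rewrite -subr_eq0 -rnorm_eq0 eq_le rnorm_ge0 andbT.
  apply: (ler_epsM K0) => eps /cvanish[N cN]; rewrite add0r.
  by rewrite (le_trans (h N))// ler_wpM2l// ltW.
have lina : linear a.
  move=> d u w; pose K := rnorm (d *: u + w) + (rnorm d * rnorm u + rnorm w).
  apply: (eq_of_le _ _ _ K) => [|N]; first by rewrite !addr_ge0 ?mulr_ge0 ?rnorm_ge0.
  rewrite /K mulrDl (le_trans (rnorm_tri _ (S N (d *: u + w)) _))// lerD//.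
    by rewrite mulrC aS.
  rewrite S_lin opprD addrACA -scalerBr mulrDl (le_trans (rnormD _ _))// lerD//.
    rewrite rnormZ -mulrA ler_wpM2l ?rnorm_ge0// rdistC mulrC; exact: aS.
  by rewrite rdistC mulrC; exact: aS.
split => //.
  apply: (compact_of_small_off ipH) => // eps /cvanish[N cN].
  exists (mkseq f N) => u us; have := aS u N; rewrite [S N u]big1 ?subr0.
    by move=> h; rewrite (le_trans h)// ler_wpM2r ?rnorm_ge0// ltW.
  move=> k _; rewrite us ?mulr0 ?scale0r//.
  by apply/mapP; exists (k : nat) => //; rewrite mem_iota/=.
move=> u n; apply: (eq_of_le _ _ _ (rnorm u)) => [|N]; first exact: rnorm_ge0.
have [nN|Nn] := ltnP n N.
  rewrite -(ip_sum_ortho (fun k => (c k)%:C * ip u (f k)) (orthoseqW ov) nN) -linearBl /=.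
  rewrite (le_trans (cauchy_schwarz ipH _ _))// (orthoseq_rnorm ipH _ ov) mulr1.
  by rewrite mulrC aS.
rewrite -(ip_sum_ortho (fun k => (c k)%:C * ip u (f k)) (orthoseqW ov) (ltnSn n)) -linearBl /=.
rewrite (le_trans (cauchy_schwarz ipH _ _))// (orthoseq_rnorm ipH _ ov) mulr1.
rewrite (le_trans (aS u n.+1))// mulrC ler_wpM2l ?rnorm_ge0// cdec//.
exact: leqW.
Qed.

End DiagonalOperator.

Section NearDiagonal.
Variables (R : realType) (H : completeNormedModType R[i]).
Variable ip : {dot H for (@Num.conj R[i])}.
Hypothesis ipH : hilbert_form ip.
Hypothesis infH : infinite_dimensional H.

Lemma bessel_vanish (w : nat -> H) h (eps : R) : orthoseq ip w -> 0 < eps ->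
  exists N, forall n, (N <= n)%N -> rnorm (ip h (w n)) <= eps.
Proof.
move=> ow eps0; pose P N := \sum_(n < N) rnorm (ip h (w n)) ^+ 2.
have supP : has_sup (range P).
  split; first by exists (P 0%N), 0%N.
  by exists (rnorm h ^+ 2) => _ [N _ <-]; apply: bessel => //; exact: orthoseqW.
have eps2 : 0 < eps ^+ 2 by rewrite exprn_gt0.
have [_ [N _ <-] PN] := sup_adherent eps2 supP; exists N => n Nn.
rewrite -(@ler_pXn2r _ 2)// ?nnegrE ?rnorm_ge0 ?(ltW eps0)//.
have Pn : P n.+1 <= sup (range P) by apply: ub_le_sup; [exact: supP.2|exists n.+1].
have : P N <= P n.
  rewrite /P (sum_ord_split (fun n => rnorm (ip h (w n)) ^+ 2) Nn) lerDl sumr_ge0//.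
  by move=> i _; exact: sqr_ge0.
by move: Pn PN; rewrite /P big_ord_recr /=; lra.
Qed.

Lemma bessel_vanish_seq (w : nat -> H) (s : seq H) (eps : R) : orthoseq ip w -> 0 < eps ->
  exists N, forall h n, h \in s -> (N <= n)%N -> rnorm (ip h (w n)) <= eps.
Proof.
move=> ow eps0; elim: s => [|h s [N sN]]; first by exists 0%N.
have [N' hN'] := bessel_vanish h ow eps0.
exists (maxn N N') => g n; rewrite inE geq_max => /orP[/eqP ->|gs] /andP[Nn N'n].
  exact: hN'.
exact: sN.
Qed.

(* Bolzano-Weierstrass in [R[i]], deduced from the compactness of a rank one
   operator on [H]. *)
Lemma bounded_scalar_cluster (z : nat -> R[i]) (M : R) : 0 <= M ->
  (forall n, rnorm (z n) <= M) ->
  exists lam, forall (eps : R) N, 0 < eps ->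
    exists2 n, (N <= n)%N & rnorm (z n - lam) < eps.
Proof.
move=> M0 zM; have [eta eta1 _] := exists_unit_perp ipH [::] infH.
have M1 : 0 < M + 1 by rewrite ltr_wpDl.
have [_ cr] := rank_one_compact ipH ((M + 1)%:C *: eta) eta.
(* Each [z n *: eta] is the image of a vector of the unit ball, because the rank one operator
   stretches [eta] by [M + 1]; the added 1 covers [M = 0]. *)
have [|l lP] := precompact_cluster (z := fun n => z n *: eta) cr.
  move=> n; exists (((M + 1)^-1%:C * z n) *: eta) => /=.
    rewrite rnormE lecR rnormZ eta1 mulr1 rnormM rnorm_real normfV (ger0_norm (ltW M1)).
    by rewrite mulrC ler_pdivrMr// mul1r (le_trans (zM n))// lerDl.
  rewrite /rank_one ipZl (ipE ipH) eta1 expr1n mulr1 scalerA; congr (_ *: _).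
  by rewrite mulrAC -rmorphM /= mulVf ?gt_eqF// mul1r.
exists (ip l eta) => eps N /(lP _ N)[n Nn nl]; exists n => //.
apply: le_lt_trans nl; have -> : z n - ip l eta = ip (z n *: eta - l) eta.
  by rewrite linearBl /= ipZl (ipE ipH) eta1 expr1n mulr1.
by rewrite (le_trans (cauchy_schwarz ipH _ _))// eta1 mulr1.
Qed.

(** For fixed [j], [<x w_j, w_m>] and [<x w_m, w_j>] tend to 0 by Bessel for [x (w j)] and
    [x' (w j)]; the adjoint handles the second. The diagonal coefficients merely cluster, at [lam],
    so indices are picked one at a time. *)
Lemma exists_near_diagonal (x x' : H -> H) (M : R) : 0 <= M -> bounded_by M x ->
  is_adjoint ip x x' ->
  exists lam v, orthoseq ip v /\
    forall k n, rnorm (ip (x (v k) - lam *: v k) (v n)) <= 2^-1 ^+ k * 2^-1 ^+ n.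
Proof.
move=> M0 xM adj; have [w ow] := exists_orthoseq ipH infH.
have [|lam lamP] := bounded_scalar_cluster (z := fun n => ip (x (w n)) (w n)) M0.
  move=> n; rewrite (le_trans (cauchy_schwarz ipH _ _))// (orthoseq_rnorm ipH _ ow).
  by rewrite mulr1 (le_trans (xM _))// (orthoseq_rnorm ipH _ ow) mulr1.
(* After [n] choices the tolerance is [4^-n], at most [2^-k * 2^-n] for every [k <= n], so a choice
   meets its constraints with all earlier ones at once. *)
pose q (s : seq nat) : R := 2^-1 ^+ size s * 2^-1 ^+ size s.
pose P (s : seq nat) m := [/\ forall j, j \in s -> (j < m)%N,
  rnorm (ip (x (w m)) (w m) - lam) <= q s,
  forall j, j \in s -> rnorm (ip (x (w m)) (w j)) <= q s &
  forall j, j \in s -> rnorm (ip (x (w j)) (w m)) <= q s].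
have [f n _|m mP] := @history_choice nat P.
  set s := mkseq f n; have q0 : 0 < q s by rewrite mulr_gt0// exprn_gt0// invr_gt0.
  have [N sN] := bessel_vanish_seq (map (x \o w) s ++ map (x' \o w) s) ow q0.
  (* The second bound puts [m] beyond all earlier indices, so that [w \o m] is again orthonormal. *)
  have [m Nm ml] := lamP _ (maxn N (\max_(j <- s) j).+1) q0.
  move: Nm; rewrite geq_max => /andP[Nm sm]; exists m; split.
  - by move=> j js; apply: leq_ltn_trans sm; exact: leq_bigmax_seq.
  - exact: ltW.
  - move=> j js; rewrite adj rnorm_ipC; apply: sN => //.
    by rewrite mem_cat; apply/orP; right; apply/mapP; exists j.
  - move=> j js; apply: sN => //.
    by rewrite mem_cat; apply/orP; left; apply/mapP; exists j.
have mem_m k n : (k < n)%N -> m k \in mkseq m n.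
  by move=> kn; apply/mapP; exists k => //; rewrite mem_iota.
have mlt k n : (k < n)%N -> (m k < m n)%N.
  by move=> kn; have [h _ _ _] := mP n; apply: h; exact: mem_m.
have mneq k n : k != n -> (m k == m n) = false.
  by rewrite neq_ltn => /orP[]/mlt h; [rewrite ltn_eqF|rewrite gtn_eqF].
exists lam, (w \o m); split.
  by move=> i j; rewrite /= ow; have [->|/mneq->//] := eqVneq i j; rewrite eqxx.
have half0 n : 0 <= 2^-1 ^+ n :> R by rewrite exprn_ge0// invr_ge0.
have halfle k n : (k <= n)%N -> 2^-1 ^+ n <= 2^-1 ^+ k :> R.
  by move=> kn; rewrite ler_wiXn2l ?invr_ge0// invf_le1// ler1n.
move=> k n; rewrite /= linearBl /= ipZl ow; have [kn|nk|<-] := ltngtP k n.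
- rewrite (mneq k n) ?ltn_eqF// mulr0 subr0; have [_ _ _ h] := mP n.
  by rewrite (le_trans (h _ (mem_m _ _ kn)))// /q size_mkseq ler_wpM2r// halfle// ltnW.
- rewrite (mneq k n) ?gtn_eqF// mulr0 subr0; have [_ _ h _] := mP k.
  by rewrite (le_trans (h _ (mem_m _ _ nk)))// /q size_mkseq ler_wpM2l// halfle// ltnW.
- rewrite eqxx mulr1; have [_ h _ _] := mP k.
  by rewrite (le_trans h)// /q size_mkseq.
Qed.

End NearDiagonal.

(** * Derivations *)

Section Derivations.
Variables (R : realType) (H : completeNormedModType R[i]).
Variable ip : {dot H for (@Num.conj R[i])}.
Hypothesis ipH : hilbert_form ip.
Hypothesis infH : infinite_dimensional H.
Variables (p : R) (D : (H -> H) -> (H -> H)).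
Hypothesis derD : is_derivation (schatten ip p) D.

(** Apply the product rule to [a \o rank_one ip u eta], which is [rank_one ip (a u) eta], and
    evaluate at [eta]: the result reads [- x (a u) = - a (x u) + D a u]. This dictates the sign in
    [x]. *)
Lemma derivation_implemented : exists x x' : H -> H, exists M,
  [/\ linear x, 0 <= M, bounded_by M x, is_adjoint ip x x' &
      forall a u, compact_operator a -> D a u = a (x u) - x (a u)].
Proof.
have [Dsch Dlin [M DM] Dmul] := derD.
have [eta eta1 _] := exists_unit_perp ipH [::] infH.
have ee : ip eta eta = 1 by rewrite (ipE ipH) eta1 expr1n.
have cr h g : compact_operator (rank_one ip h g) by exact: rank_one_compact.
pose x h := - D (rank_one ip h eta) eta.
have linx : linear x.
  move=> c h g; rewrite /x.
  have -> : rank_one ip (c *: h + g) eta = c *: rank_one ip h eta + rank_one ip g eta.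
    by apply/funext => z; rewrite /rank_one scalerDr scalerA mulrC -scalerA.
  by rewrite Dlin//= opprD scalerN.
have Dx a u : compact_operator a -> D a u = a (x u) - x (a u).
  move=> ca; have lina := ca.1.
  have := Dmul a (rank_one ip u eta) ca (cr _ _).
  have -> : a \o rank_one ip u eta = rank_one ip (a u) eta.
    by apply/funext => z; rewrite /= /rank_one (linZ lina).
  move=> /(congr1 (fun g => g eta)) /=.
  rewrite /x opprK -scaleN1r (linZ lina) scaleN1r => ->.
  by rewrite addrA addNr add0r /= /rank_one ee scale1r.
(* The constant in [is_derivation] carries no sign, hence the absolute value. *)
have xM : bounded_by `|M| x.
  move=> h; rewrite /x rnormN.
  have cD : compact_operator (D (rank_one ip h eta)) by have [] := Dsch _ (cr h eta).
  apply: (le_trans (opnorm_ub cD _)); first by rewrite eta1.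
  apply: (le_trans (DM _ (cr _ _))).
  have op0 : 0 <= opnorm (rank_one ip h eta).
    by apply: le_trans (opnorm_ub (cr h eta) (u := 0) _); rewrite ?rnorm_ge0 ?rnorm0.
  rewrite (le_trans (ler_wpM2r op0 (ler_norm M)))// ler_wpM2l//.
  apply: opnorm_le; first exact: rnorm_ge0.
  move=> u; rewrite /rank_one rnormZ mulrC ler_wpM2l ?rnorm_ge0//.
  by rewrite (le_trans (cauchy_schwarz ipH _ _))// eta1 mulr1.
have adjD h : exists T', is_adjoint ip (D (rank_one ip eta h)) T'.
  by have [_ [s [_ _ [T' adj _]] _]] := Dsch _ (cr eta h); exists T'.
have [T' T'P] := choice adjD.
exists x, (fun h => T' h eta + (ip (x eta) eta)^* *: h), `|M|.
(* Pairing [D (rank_one ip eta h) z] with [eta] gives [<x z, h> - <z, h> <x eta, eta>]; moving the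
   last term across explains the correction added to [T' h eta]. *)
split => // z h; rewrite linearDr /= ipZr conjCK -T'P Dx// /rank_one (linZ linx).
by rewrite linearBl /= !ipZl ee mulr1 [X in _ - X]mulrC subrK.
Qed.

Hypothesis p1 : 1 <= p.

Lemma derivation_diag (y : H -> H) (M : R) (e f v : nat -> H) :
  0 <= M -> bounded_by M y -> linear y ->
  (forall a u, compact_operator a -> D a u = a (y u) - y (a u)) ->
  orthoseq ip e -> orthoseq ip f -> orthoseq ip v ->
  (forall k n, rnorm (ip (y (v k)) (v n)) <= 2^-1 ^+ k * 2^-1 ^+ n) ->
  psummable p (fun n => rnorm (ip (y (e n)) (f n))).
Proof.
move=> M0 yM liny Dy oe of_ ov yv; have p0 : 0 <= p by rewrite (le_trans ler01).
have half0 n : 0 <= 2^-1 ^+ n :> R by rewrite exprn_ge0// invr_ge0.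
apply: psummable_of_weights => // [n|c c0 cdec cvanish]; first exact: rnorm_ge0.
have [a [ca aS av]] := exists_diag_operator ipH c0 cdec cvanish of_ ov.
have Dsch := let: And4 h _ _ _ := derD in h a ca.
have := schatten_diag ipH p1 infH Dsch oe ov.
have K0 : 0 <= c 0%N * 2 by rewrite mulr_ge0.
move=> sD; have c2n n : 0 <= c 0%N * 2 * 2^-1 ^+ n by rewrite mulr_ge0.
have := psummableD p0 (fun n => rnorm_ge0 (ip (D a (e n)) (v n))) c2n sD
  (psummable_geometric p1 K0).
apply: psummable_le => // n; rewrite mulr_ge0 ?rnorm_ge0//=.
(* Boundedness of [y] permits truncating the series of [a (e n)]; each term is then at most
   [c 0 * 2^-k * 2^-n], and the factor 2 is the sum over [k]. *)
have tail : rnorm (ip (y (a (e n))) (v n)) <= c 0%N * 2 * 2^-1 ^+ n.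
  apply: (ler_epsM M0) => eps /cvanish[N cN].
  set s := \sum_(k < N) ((c k)%:C * ip (e n) (f k)) *: v k.
  rewrite -[a (e n)](subrK s) (linD liny) linearDl /= addrC.
  rewrite (le_trans (rnormD _ _))// lerD//; last first.
    rewrite (le_trans (cauchy_schwarz ipH _ _))// (orthoseq_rnorm ipH _ ov) mulr1.
    rewrite (le_trans (yM _))// ler_wpM2l// (le_trans (aS _ _))//.
    by rewrite (orthoseq_rnorm ipH _ oe) mulr1 ltW.
  rewrite /s (lin_sum liny) linear_sumlz (le_trans (rnorm_sum _ _ _))//.
  apply: (@le_trans _ _ (\sum_(k < N) c 0%N * 2^-1 ^+ n * 2^-1 ^+ k)).
    apply: ler_sum => k _; rewrite (linZ liny) /= ipZl !rnormM rnorm_real (ger0_norm (c0 _)).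
    rewrite -mulrA -[leRHS]mulrA ler_pM ?mulr_ge0 ?rnorm_ge0 ?cdec//.
    rewrite mulrC [leRHS]mulrC -[leLHS]mulr1.
    rewrite (le_trans _ (yv k n))// mulr1 ler_piMr ?rnorm_ge0//.
    rewrite (le_trans (cauchy_schwarz ipH _ _))// (orthoseq_rnorm ipH _ oe).
    by rewrite (orthoseq_rnorm ipH _ of_) mulr1.
  rewrite -mulr_sumr -!mulrA ler_wpM2l// mulrC ler_wpM2r//.
  exact: sum_half_le2.
have -> : c n * rnorm (ip (y (e n)) (f n)) = rnorm (ip (a (y (e n))) (v n)).
  by rewrite av rnormM rnorm_real (ger0_norm (c0 _)).
have -> : ip (a (y (e n))) (v n) = ip (D a (e n)) (v n) + ip (y (a (e n))) (v n).
  by rewrite Dy// linearBl /= subrK.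
by rewrite (le_trans (rnormD _ _))// lerD2l.
Qed.

End Derivations.

Theorem theorem5p1 (R : realType) (H : completeNormedModType R[i])
    (ip : {dot H for (@Num.conj R[i])}) (p : R)
    (D : (H -> H) -> (H -> H)) :
  hilbert_form ip -> separable H -> infinite_dimensional H ->
  1 <= p ->
  is_derivation (schatten ip p) D ->
  exists2 x : H -> H, schatten ip p x &
    forall a : H -> H, compact_operator a -> D a = (a \o x) - (x \o a).
Proof.
move=> ipH _ infH p1 derD.
have [x [x' [M [linx M0 xM adj Dx]]]] := derivation_implemented ipH infH derD.
have [lam [v [ov xv]]] := exists_near_diagonal ipH infH M0 xM adj.
pose y u := x u - lam *: u; pose y' u := x' u - lam^* *: u.
have liny : linear y.
  move=> c u w; rewrite /y linx !scalerDr scalerN !scalerA mulrC opprD.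
  by rewrite addrACA.
have adjy : is_adjoint ip y y'.
  by move=> u w; rewrite /y /y' linearBl linearBr /= ipZl ipZr conjCK adj.
have yM : bounded_by (M + rnorm lam) y.
  by move=> u; rewrite mulrDl (le_trans (rnormB _ _))// lerD// rnormZ.
(* Scalars commute with [a], so passing from [x] to [y] leaves the commutator unchanged. *)
have Dy a u : compact_operator a -> D a u = a (y u) - y (a u).
  move=> ca; rewrite Dx// /y (linB ca.1) (linZ ca.1) opprB.
  by rewrite addrA subrK.
exists y; last by move=> a ca; apply/funext => u; rewrite Dy.
apply: (schatten_of_diag ipH p1 infH liny adjy) => e f oe of_.
apply: (derivation_diag ipH infH derD p1 _ yM liny Dy oe of_ ov xv).
by rewrite addr_ge0 ?rnorm_ge0.
Qed.
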